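(* Let $n\ge 2$ and $M\ge 2$ be integers, let $s\in[-1,1)$, and let $h:[-1,1)\to\mathbb{R}$. If $f\in U_h^{n,s}$ and $C\in C(n,M,s)$, then $$E_h(C)\le \mathcal{G}_h(n,M,s)\le M\bigl(f_0M-f(1)\bigr),$$ where $f_0$ is the zeroth Gegenbauer coefficient of $f$. Moreover, equality holds throughout (i.e. $E_h(C)=\mathcal{G}_h(n,M,s)=M(f_0M-f(1))$) if and only if both of the following conditions hold: (a) $f(t)=h(t)$ for every $t\in\{\langle x,y\rangle: x\ne y\in C\}$; (b) $f_iM_i(C)=0$ for all $i=1,2,3,\ldots$.
   Context: Codes and energy. $\mathbb{S}^{n-1}$ is the unit sphere in $\mathbb{R}^n$; a spherical code is a finite subset $C\subset\mathbb{S}^{n-1}$. The $h$-energy is $E_h(C)=\sum_{x,y\in C,\,x\neq y}h(\langle x,y\rangle)$ (sum over ordered pairs). $s(C)=\max\{\langle x,y\rangle:x,y\in C,x\ne y\}$; $C(n,M,s)=\{C\subset\mathbb{S}^{n-1}:|C|=M,\ s(C)=s\}$; $\mathcal{G}_h(n,M,s)=\sup_{C\in C(n,M,s)}E_h(C)$ (with $\sup\emptyset=-\infty$). Gegenbauer polynomials. $P_i^{(n)}$ is defined by $P_0^{(n)}(t)=1$, $P_1^{(n)}(t)=t$ and $(i+n-2)P_{i+1}^{(n)}(t)=(2i+n-2)tP_i^{(n)}(t)-iP_{i-1}^{(n)}(t)$ for $i\ge1$, so $P_i^{(n)}(1)=1$; these are orthogonal on $[-1,1]$ with respect to the weight $(1-t^2)^{(n-3)/2}$.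 A continuous $f$ on $[-1,1]$ has Gegenbauer expansion $f=\sum_{i\ge0}f_iP_i^{(n)}$ (convergence in $L_2$ with respect to the weight) with $f_i=\int_{-1}^1 fP_i^{(n)}(1-t^2)^{(n-3)/2}dt\big/\int_{-1}^1 (P_i^{(n)})^2(1-t^2)^{(n-3)/2}dt$. Feasible set. $U_h^{n,s}$ is the set of $f\in C([-1,1])$ such that (F1) $f(t)\ge h(t)$ for every $t\in[-1,s]$, and (F2) $f_i\le0$ for all $i=1,2,3,\ldots$. Moments. For $i\ge1$, $M_i(C)=\sum_{x,y\in C}P_i^{(n)}(\langle x,y\rangle)$ (sum over all ordered pairs, including $x=y$). *)

(* Defs.v *)
From HB Require Import structures.
From mathcomp Require Import all_boot all_order all_algebra finmap.
From mathcomp Require Import all_classical all_reals all_analysis.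

Set Implicit Arguments.
Unset Strict Implicit.
Unset Printing Implicit Defensive.

Import Order.TTheory GRing.Theory Num.Theory.
Import numFieldNormedType.Exports.

Local Open Scope classical_set_scope.
Local Open Scope ring_scope.

Section SphericalCodes.
Context {R : realType}.
Implicit Types (n M i : nat) (s t : R) (f h : R -> R).

Definition inner n (x y : 'rV[R]_n) : R := \sum_(k < n) x 0 k * y 0 k.

(* The library norm on 'rV[R]_n is the sup norm, so the Euclidean sphere is
   defined through the inner product. *)
Definition sphere n : set 'rV[R]_n := [set x | inner x x = 1].

Definition inner_products n (C : {fset 'rV[R]_n}) : set R :=
  [set t | exists x y, [/\ x \in C, y \in C, x != y & t = inner x y]].

Definition is_max (A : set R) (m : R) : Prop := A m /\ ubound A m.

Definition codes n M s : set {fset 'rV[R]_n} :=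
  [set C : {fset 'rV[R]_n} | [/\ [set` C] `<=` @sphere n, #|` C| = M &
               is_max (inner_products C) s]].

(* A function on [-1, 1) or on [-1, 1] is represented by a total function
   R -> R; its values outside of that interval are never used. *)
Definition energy n h (C : {fset 'rV[R]_n}) : R :=
  \sum_(x <- C) \sum_(y <- C | x != y) h (inner x y).

Definition max_energy h n M s : \bar R :=
  ereal_sup [set (energy h C)%:E | C in @codes n M s].

Fixpoint gegenbauer n i : {poly R} :=
  match i with
  | 0 => 1
  | j.+1 =>
    match j with
    | 0 => 'X
    | k.+1 =>
      (j%:R + n%:R - 2)^-1 *:
        ((2 * j%:R + n%:R - 2) *: ('X * gegenbauer n j)
         - j%:R *: gegenbauer n k)
    end
  end.

(* Since 0 `^ a = 0 for a != 0, the weight vanishes at -1 and 1 when n = 2,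
   where it should be infinite; this does not affect the integrals. *)
Definition weight n t : R := (1 - t ^+ 2) `^ ((n%:R - 3) / 2).

Definition weighted_integral n f : R :=
  \int[lebesgue_measure]_(t in `[(-1 : R), 1]) (f t * weight n t).

Definition gegenbauer_coef n f i : R :=
  weighted_integral n (fun t => f t * (gegenbauer n i).[t]) /
  weighted_integral n (fun t => (gegenbauer n i).[t] ^+ 2).

Definition feasible h n s : set (R -> R) :=
  [set f | [/\ {within `[(-1 : R), 1], continuous f},
               forall t, -1 <= t <= s -> h t <= f t &
               forall i, (1 <= i)%N -> gegenbauer_coef n f i <= 0]].

Definition moment n i (C : {fset 'rV[R]_n}) : R :=
  \sum_(x <- C) \sum_(y <- C) (gegenbauer n i).[inner x y].

End SphericalCodes.

(* Main.v *)
(** Write [P_i] for the Gegenbauer polynomials and [f_i] for the coefficients of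
    [f].  Everything follows from the identity
    [sum_(x,y in C) f(<x,y>) = f_0 M^2 + sum_(i >= 1) f_i M_i(C)],
    which needs [M_i(C) >= 0] and the uniform convergence of the expansion of [f].

    Positivity: the addition formula writes the kernel [P_i(<x,y>)] in dimension
    [n + 1] as a nonnegative combination of products [A(x) A(y) K(x', y')] with
    [K] a kernel of the same kind in dimension [n]; positive definiteness follows
    by induction from the plane, where [P_i] is a Chebyshev polynomial.  In
    particular [|P_i| <= 1] on [[-1, 1]].

    Convergence: the powers of [(1 + t) / 2] have nonnegative Gegenbauer
    coefficients and concentrate at [1], so [f_i <= 0] for [i >= 1] gives
    [f(1) <= sum_(i < N) f_i] for all [N >= 1]; hence [sum |f_i|] converges.
    Averaging [f - sum_(i < N) f_i P_i] against the powers of a polynomial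
    peaking at an arbitrary point [t] bounds its value at [t] by the tail
    of [sum |f_i|]. *)

Require Import Defs.
From mathcomp Require Import all_boot all_order all_algebra finmap ring lra zify.
From mathcomp Require Import all_classical all_reals all_analysis measurable_realfun.

Import Order.TTheory GRing.Theory Num.Theory.
Import numFieldNormedType.Exports.

Local Open Scope classical_set_scope.
Local Open Scope ring_scope.

Set Implicit Arguments.
Unset Strict Implicit.
Unset Printing Implicit Defensive.

(** * The addition formula and positive definiteness *)

Section Addition.
Variable R : realFieldType.
Implicit Types (mu lam rho t N tau : R).

(* The zonal kernel [(|x| |y|)^i P_i(<x,y> / (|x| |y|))] in dimension [mu + 2],
   as a polynomial in [N = |x|^2 |y|^2] and [tau = <x,y>]. *)
Fixpoint zonal mu N tau i : R :=
  match i with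
  | 0 => 1
  | j.+1 =>
    match j with
    | 0 => tau
    | k.+1 => (j%:R + mu)^-1 *
       ((2 * j%:R + mu) * (tau * zonal mu N tau j)
        - j%:R * (N * zonal mu N tau k))
    end
  end.

(* [m! C_m^lam], homogenized: [rho] stands for [|x|^2] and [t] for a coordinate
   of [x]. *)
Fixpoint ugegen lam rho t m : R :=
  match m with
  | 0 => 1
  | j.+1 =>
    match j with
    | 0 => 2 * lam * t
    | k.+1 => 2 * (j%:R + lam) * t * ugegen lam rho t j
       - j%:R * (k%:R + 2 * lam) * rho * ugegen lam rho t k
    end
  end.

Lemma ugegenSS lam rho t m : ugegen lam rho t m.+2 =
  2 * (m.+1%:R + lam) * t * ugegen lam rho t m.+1
  - m.+1%:R * (m%:R + 2 * lam) * rho * ugegen lam rho t m.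
Proof. by []. Qed.

(** Contiguity relation $(m+1) C_{m+1}^{lam} = 2 lam (t C_m^{lam+1} - C_{m-1}^{lam+1})$ cleared of
    factorials; it follows by induction along the three-term recurrence. At [m = 0] the factor
    [m%:R] cancels the term with the truncated index. *)
Lemma ugegen_shift lam rho t m : ugegen lam rho t m.+1 =
  2 * lam * (t * ugegen (lam + 1) rho t m
             - m%:R * rho * ugegen (lam + 1) rho t m.-1).
Proof.
elim/ltn_ind: m => -[_|[_|m IH]]; first by rewrite /=; ring.
  by rewrite /=; ring.
rewrite ugegenSS (IH m.+1) // (IH m) // ?succnK (ugegenSS (lam + 1)).
case: m {IH} => [|m]; first by rewrite /=; ring.
by rewrite ?succnK !ugegenSS -!natr1; ring.
Qed.

(** Obtained from [ugegen_shift] by eliminating [t * ugegen (lam + 1) rho t m] through the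
    recurrence. *)
Lemma ugegen_lower lam rho t m :
  (m%:R + (lam + 1)) * ugegen lam rho t m.+1 =
  lam * (ugegen (lam + 1) rho t m.+1
         - m.+1%:R * m%:R * rho * ugegen (lam + 1) rho t m.-1).
Proof.
rewrite ugegen_shift; case: m => [|m]; first by rewrite /=; ring.
by rewrite ?succnK ugegenSS -!natr1; ring.
Qed.

(** The factor [rho - t ^+ 2], the squared length of the remaining coordinates, is the price for
    returning from [lam + 1] to [lam]. *)
Lemma ugegen_raise1 lam rho t m :
  2 * lam * (rho - t ^+ 2) * ugegen (lam + 1) rho t m =
  (m%:R + 2 * lam) * rho * ugegen lam rho t m - t * ugegen lam rho t m.+1.
Proof.
case: m => [|m]; first by rewrite /=; ring.
rewrite (ugegen_shift lam _ _ m.+1) (ugegen_shift lam _ _ m) succnK.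
case: m => [|m]; first by rewrite /=; ring.
by rewrite !succnK !ugegenSS -!natr1; ring.
Qed.

Lemma ugegen_raise lam rho t m :
  4 * lam * (m.+1%:R + lam) * (rho - t ^+ 2) * ugegen (lam + 1) rho t m =
  (m%:R + 2 * lam) * (m.+1%:R + 2 * lam) * rho * ugegen lam rho t m
  - ugegen lam rho t m.+2.
Proof.
transitivity (2 * (m.+1%:R + lam) *
  (2 * lam * (rho - t ^+ 2) * ugegen (lam + 1) rho t m)); first by ring.
by rewrite ugegen_raise1 ugegenSS -natr1; ring.
Qed.

(** * Coefficients of the addition formula *)

Fixpoint poch mu m : R := if m is k.+1 then poch mu k * (mu + k%:R) else 1.

Lemma pochS mu m : poch mu m.+1 = poch mu m * (mu + m%:R).
Proof. by []. Qed.

(** Coefficient of $P_{k-1}$ in the expansion of $t P_k$ in dimension [mu + 1], where $P_{k+1}$ has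
    coefficient [1 - rec_coef mu k]. *)
Definition rec_coef mu k : R := k%:R / (2 * k%:R + mu - 1).

(** In closed form $4^k (mu/2)_k^2$ times the dimension of the space of spherical harmonics of
    degree [k] in dimension [mu + 1]. *)
Fixpoint dimension_coef mu k : R :=
  if k is j.+1 then
    dimension_coef mu j * (4 * (mu / 2 + j%:R) ^+ 2 * (1 - rec_coef mu j) *
                  (2 * j%:R + mu + 1) / j.+1%:R)
  else 1.

(** The value 0 for [k > i] allows the same summation range for several degrees [i] at once. *)
Definition addition_coef mu i k : R :=
  if (k <= i)%N then
    i`!%:R / (poch mu i * (i - k)`!%:R * poch mu (i + k)) * dimension_coef mu k
  else 0.

Lemma poch_gt0 mu m : 0 < mu -> 0 < poch mu m.
Proof.
move=> mu0; elim: m => //= m IH; apply: mulr_gt0 => //.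
by rewrite ltr_wpDr.
Qed.

Lemma rec_coef_lt1 mu k : 1 <= mu -> rec_coef mu k < 1.
Proof.
move=> mu1; rewrite /rec_coef; case: k => [|k]; first by rewrite mul0r.
have k0 := ler0n R k.
rewrite ltr_pdivrMr; first by rewrite -natr1; lra.
by rewrite -natr1; lra.
Qed.

Lemma addition_coef_ge0 mu i k : 1 <= mu -> 0 <= addition_coef mu i k.
Proof.
move=> mu1; rewrite /addition_coef; case: ifP => // _.
have mu0 : 0 < mu by lra.
apply: mulr_ge0.
  by rewrite divr_ge0 // !mulr_ge0 // ltW // poch_gt0.
elim: k => //= k IH; apply: mulr_ge0 => //.
have := rec_coef_lt1 k mu1; have k0 := ler0n R k => h.
rewrite !mulr_ge0 ?sqr_ge0 ?invr_ge0 //; lra.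
Qed.

Lemma rec_coef_mul mu k : 1 <= mu -> rec_coef mu k * (2 * k%:R + mu - 1) = k%:R.
Proof.
move=> mu1; case: k => [|k]; first by rewrite /rec_coef !mul0r.
have k0 := ler0n R k.
by rewrite /rec_coef mulfVK // -natr1; apply/eqP; lra.
Qed.

Lemma zonalSS mu N tau i : 0 <= mu ->
  (i.+1%:R + mu) * zonal mu N tau i.+2 =
  (2 * i.+1%:R + mu) * tau * zonal mu N tau i.+1 - i.+1%:R * N * zonal mu N tau i.
Proof.
move=> mu0; have i0 := ler0n R i.
rewrite [zonal mu N tau i.+2]/= mulVKf; first by rewrite /=; ring.
by rewrite -natr1; apply/eqP; lra.
Qed.

(* At [k = 0] the value [rec_coef _ 0 = 0 / (mu - 1) = 0] makes the formula valid
   even when [mu = 1]. *)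
Lemma zonal_rec mu N tau k : 1 <= mu ->
  tau * zonal (mu - 1) N tau k =
  (1 - rec_coef mu k) * zonal (mu - 1) N tau k.+1
  + rec_coef mu k * N * zonal (mu - 1) N tau k.-1.
Proof.
move=> mu1; case: k => [|k]; first by rewrite /rec_coef !mul0r /=; ring.
have k0 := ler0n R k.
have mu0 : 0 <= mu - 1 by lra.
have := zonalSS N tau k mu0.
rewrite succnK => e.
have d0 : 2 * k.+1%:R + mu - 1 != 0 by rewrite -natr1; apply/eqP; lra.
apply: (mulfI d0).
transitivity ((2 * k.+1%:R + (mu - 1)) * tau * zonal (mu - 1) N tau k.+1).
  by ring.
have -> : (2 * k.+1%:R + (mu - 1)) * tau * zonal (mu - 1) N tau k.+1 =
  (k.+1%:R + (mu - 1)) * zonal (mu - 1) N tau k.+2 + k.+1%:R * N * zonal (mu - 1) N tau k.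
  by rewrite e; ring.
set d := (_ + mu - 1); set K := rec_coef _ _.
transitivity (d * zonal (mu - 1) N tau k.+2 - K * d * zonal (mu - 1) N tau k.+2
  + K * d * N * zonal (mu - 1) N tau k); last by rewrite ?succnK; ring.
by rewrite rec_coef_mul // /d; ring.
Qed.

(** Apart from the constant, a product of a function of [(rho, t)] and the same function of
    [(sig, s)]; this separation is what transfers positive definiteness from the lower dimension. *)
Definition addition_term mu i k rho t sig s : R :=
  addition_coef mu i k * ugegen (mu / 2 + k%:R) rho t (i - k)
                 * ugegen (mu / 2 + k%:R) sig s (i - k).

Lemma addition_coef_gt mu i k : (i < k)%N -> addition_coef mu i k = 0.
Proof. by rewrite ltnNge /addition_coef => /negbTE ->. Qed.

Definition prev (a : nat -> R) k := if k is j.+1 then a j else 0.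

Section Ratios.
Variables (mu : R).
Hypothesis mu1 : 1 <= mu.

Let pn m : poch mu m != 0.
Proof. by apply/lt0r_neq0/poch_gt0/(lt_le_trans _ mu1)/ltr01. Qed.
Let fn m : m`!%:R != 0 :> R. Proof. by rewrite pnatr_eq0 -lt0n fact_gt0. Qed.

(** The ratios of neighbouring coefficients, here in [i] and next in [k], are rational, so the
    addition formula reduces to an identity of rational functions. Writing the degree as [m + k]
    avoids truncated subtraction. *)
Lemma addition_coefS m k : addition_coef mu (m + k).+1 k =
  addition_coef mu (m + k) k * ((m + k).+1%:R /
    ((mu + (m + k)%:R) * m.+1%:R * (mu + (m + k + k)%:R))).
Proof.
rewrite /addition_coef (_ : (k <= (m + k).+1)%N = true); last by lia.
rewrite leq_addl addnK subSn ?leq_addl // addnK addSn !factS [poch mu _.+1]/=.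
rewrite [poch mu (m + k + k).+1]/= !natrM.
have h0 j : mu + j%:R != 0.
  by move: mu1 => mu1'; have j0 := ler0n R j; apply/eqP; lra.
by field; rewrite -!natrD nat1r ?pn ?fn ?h0 pnatr_eq0.
Qed.

Lemma addition_coefSr m k : addition_coef mu (m.+1 + k) k.+1 =
  addition_coef mu (m.+1 + k) k * (m.+1%:R / (mu + (m.+1 + k + k)%:R) *
   (4 * (mu / 2 + k%:R) ^+ 2 * (1 - rec_coef mu k) * (2 * k%:R + mu + 1) / k.+1%:R)).
Proof.
rewrite /addition_coef (_ : (k < m.+1 + k)%N = true); last by lia.
rewrite leq_addl addnK.
rewrite (_ : (m.+1 + k - k.+1 = m)%N); last by lia.
rewrite addnS (factS m) (pochS mu (m.+1 + k + k)) [dimension_coef mu _.+1]/= !natrM.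
set q := dimension_coef _ _; set K := rec_coef _ _.
have h0 j : mu + j%:R != 0.
  by move: mu1 => mu1'; have j0 := ler0n R j; apply/eqP; lra.
have := mu1 => mu1'; have m0 := ler0n R m; have k0 := ler0n R k.
by field; rewrite ?pn ?fn !nat1r -!natrD ?h0 !pnatr_eq0.
Qed.

End Ratios.

(* The coefficient identity of the addition formula, after the contiguity
   relations have expressed everything through [X = ugegen m+2] and
   [Y = rho * ugegen m]. *)
Lemma addition_core mu lam (m k : nat) e0 e1 e2 ep en B X Y Bp Bn B' X' Y' Bp' Bn' :
  1 <= mu ->
  mu = 2 * (lam - k%:R) ->
  e1 = e0 * ((m + k).+1%:R /
    ((mu + (m + k)%:R) * m.+1%:R * (mu + (m + k + k)%:R))) ->
  e2 = e1 * ((m.+1 + k).+1%:R /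
    ((mu + (m.+1 + k)%:R) * m.+2%:R * (mu + (m.+1 + k + k)%:R))) ->
  en = e1 * (m.+1%:R / (mu + (m.+1 + k + k)%:R) *
   (4 * lam ^+ 2 * (1 - rec_coef mu k) * (2 * k%:R + mu + 1) / k.+1%:R)) ->
  (k = 0%N -> ep = 0) ->
  (forall k', k = k'.+1 -> e1 = ep * (m.+2%:R / (mu + (m.+2 + k' + k')%:R) *
   (4 * (lam - 1) ^+ 2 * (2 * k'%:R + mu + 1) / k%:R))) ->
  2 * (m.+1%:R + lam) * B = X + m.+1%:R * (m%:R + 2 * lam) * Y ->
  2 * (m.+1%:R + lam) * B' = X' + m.+1%:R * (m%:R + 2 * lam) * Y' ->
  (m.+1%:R + lam) * Bp = (lam - 1) * (X - m.+2%:R * m.+1%:R * Y) ->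
  (m.+1%:R + lam) * Bp' = (lam - 1) * (X' - m.+2%:R * m.+1%:R * Y') ->
  4 * lam * (m.+1%:R + lam) * Bn = (m%:R + 2 * lam) * (m.+1%:R + 2 * lam) * Y - X ->
  4 * lam * (m.+1%:R + lam) * Bn' = (m%:R + 2 * lam) * (m.+1%:R + 2 * lam) * Y' - X' ->
  ((m + k).+1%:R + mu) * (e2 * X * X') + (m + k).+1%:R * (e0 * Y * Y') =
  (2 * (m + k).+1%:R + mu) *
   (e1 * B * B' + ep * Bp * Bp' + rec_coef mu k.+1 * (en * Bn * Bn')).
Proof.
move=> mu1 emu E1 E2 En Ep0 Ep.
have m0 := ler0n R m; have k0 := ler0n R k.
have dn : m.+1%:R + lam != 0 by rewrite -natr1; apply/eqP; lra.
have ln : lam != 0 by apply/eqP; lra.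
(* The contiguity hypotheses are solved for [B], [Bp], [Bn] and their primed versions, which leaves
   only [X], [Y], [X'], [Y']. *)
have eB u v : 2 * (m.+1%:R + lam) * u = v -> u = v / (2 * (m.+1%:R + lam)).
  by move=> <-; rewrite mulrC mulKf // mulf_neq0 // pnatr_eq0.
have eBp u v : (m.+1%:R + lam) * u = v -> u = v / (m.+1%:R + lam).
  by move=> <-; rewrite mulrC mulKf // mulf_neq0 // pnatr_eq0.
have eBn u v : 4 * lam * (m.+1%:R + lam) * u = v ->
  u = v / (4 * lam * (m.+1%:R + lam)).
  by move=> <-; rewrite mulrC mulKf // !mulf_neq0 // pnatr_eq0.
move=> /eB -> /eB -> /eBp -> /eBp -> /eBn -> /eBn ->.
rewrite {}E2 {}En {eB eBp eBn} /rec_coef {mu}emu in mu1 Ep E1 *.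
case: k k0 mu1 Ep0 Ep E1 => [|k] k0 mu1 Ep0 Ep E1.
  rewrite Ep0 // E1 [0%:R]mulr0n !mul0r; rewrite mulr0n in mu1.
  field; do ?[apply/andP; split]; by apply/eqP; lra.
have k1 := ler0n R k; rewrite -natr1 in k0 mu1.
(* The ratio is inverted, so that [ep] as well as [e1] becomes a multiple of [e0]. *)
have {}Ep : ep = e1 / (m.+2%:R / (2 * (lam - k.+1%:R) + (m.+2 + k + k)%:R) *
   (4 * (lam - 1) ^+ 2 * (2 * k%:R + 2 * (lam - k.+1%:R) + 1) / k.+1%:R)).
  by rewrite (Ep k) //; field; do ?[apply/andP; split]; apply/eqP; lra.
rewrite {Ep0}Ep E1.
by field; do ?[apply/andP; split]; apply/eqP; lra.
Qed.

(** This compares the coefficients of the [k]-th lower-dimensional kernel in the three-term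
    recurrence of [zonal], with [tau = t * s + u]: the part [t * s] preserves [k], while [u] moves
    it by one in both directions through [zonal_rec]. *)
Lemma addition_term_rec mu i k rho t sig s : 1 <= mu ->
  (i.+1%:R + mu) * addition_term mu i.+2 k rho t sig s
  + i.+1%:R * (rho * sig) * addition_term mu i k rho t sig s =
  (2 * i.+1%:R + mu) *
  (t * s * addition_term mu i.+1 k rho t sig s
   + prev (fun j => (1 - rec_coef mu j) * addition_term mu i.+1 j rho t sig s) k
   + rec_coef mu k.+1 * ((rho - t ^+ 2) * (sig - s ^+ 2))
     * addition_term mu i.+1 k.+1 rho t sig s).
Proof.
move=> mu1; have i0 := ler0n R i.
(* The cases [k > i + 2], [k = i + 2] and [k = i + 1] are separate, because some coefficients vanish
   there and the differences [i - k] truncate. *)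
have [kgt|] := ltnP i.+2 k.
  rewrite /addition_term (@addition_coef_gt mu i.+2) // (@addition_coef_gt mu i k); last by lia.
  rewrite (@addition_coef_gt mu i.+1 k) ?(@addition_coef_gt mu i.+1 k.+1); try lia.
  case: k kgt => //= k kgt; rewrite (@addition_coef_gt mu i.+1 k) //; ring.
rewrite leq_eqVlt => /predU1P[->|].
  rewrite /addition_term /prev (@addition_coef_gt mu i.+1 i.+2) //.
  rewrite (@addition_coef_gt mu i.+1 i.+3) // (@addition_coef_gt mu i i.+2) //.
  rewrite !subnn /=.
  rewrite (@addition_coefSr mu mu1 0 i.+1) (@addition_coefS mu mu1 0 i.+1).
  set e := addition_coef _ _ _; set K := rec_coef _ _.
  field; do ?[apply/andP; split]; apply/eqP; lra.
rewrite ltnS leq_eqVlt => /predU1P[->|].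
  rewrite /addition_term /prev (@addition_coef_gt mu i.+1 i.+2) // (@addition_coef_gt mu i i.+1) //.
  rewrite !subSnn !subnn /=.
  rewrite (@addition_coefS mu mu1 0 i.+1) (@addition_coefSr mu mu1 0 i).
  set e := addition_coef _ _ _; set K := rec_coef _ _.
  field; do ?[apply/andP; split]; apply/eqP; lra.
rewrite ltnS => ki; rewrite -(subnK ki); move: (i - k)%N => m.
have emu : mu = 2 * ((mu / 2 + k%:R) - k%:R) by field.
have lamS j : mu / 2 + j.+1%:R = mu / 2 + j%:R + 1 by rewrite -[j.+1%:R]natr1 addrA.
pose lam := mu / 2 + k%:R.
have lk : 0 < lam by rewrite /lam; have k0 := ler0n R k; lra.
have dn : m.+1%:R + lam != 0.
  by have m0 := ler0n R m; apply/lt0r_neq0; rewrite -natr1; lra.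
(* For [k = 0] no term of index [k - 1] exists; [Bp] is then defined by the relation that
   [addition_core] requires, and it is multiplied by [ep = 0]. *)
pose Bp r x := if k is k'.+1 then ugegen (mu / 2 + k'%:R) r x m.+2 else
  (lam - 1) * (ugegen lam r x m.+2
               - m.+2%:R * m.+1%:R * (r * ugegen lam r x m)) / (m.+1%:R + lam).
have BpE r x : (m.+1%:R + lam) * Bp r x = (lam - 1) *
    (ugegen lam r x m.+2 - m.+2%:R * m.+1%:R * (r * ugegen lam r x m)).
  rewrite /Bp {Bp}; clear emu lk ki; case: k @lam dn => [|k] lam dn.
    by rewrite mulrC divfK.
  have -> : mu / 2 + k%:R = lam - 1 by rewrite /lam lamS addrK.
  by have := ugegen_lower (lam - 1) r x m.+1; rewrite subrK succnK => ->; ring.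
rewrite /addition_term.
rewrite (_ : (m + k).+2 - k = m.+2)%N; last by lia.
rewrite (_ : (m + k).+1 - k = m.+1)%N; last by lia.
rewrite (_ : (m + k) - k = m)%N; last by lia.
rewrite (_ : (m + k).+1 - k.+1 = m)%N; last by lia.
rewrite (lamS k) -/lam.
transitivity (((m + k).+1%:R + mu) *
  (addition_coef mu (m.+1 + k).+1 k * ugegen lam rho t m.+2 * ugegen lam sig s m.+2) +
  (m + k).+1%:R *
  (addition_coef mu (m + k) k * (rho * ugegen lam rho t m) *
   (sig * ugegen lam sig s m))); first by rewrite addSn; ring.
pose ep := if k is k'.+1 then (1 - rec_coef mu k') * addition_coef mu (m + k).+1 k' else 0.
have := addition_core (k := k) (lam := lam) (B := t * ugegen lam rho t m.+1)
  (B' := s * ugegen lam sig s m.+1) (X := ugegen lam rho t m.+2)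
  (X' := ugegen lam sig s m.+2) (Y := rho * ugegen lam rho t m)
  (Y' := sig * ugegen lam sig s m)
  (Bn := (rho - t ^+ 2) * ugegen (lam + 1) rho t m)
  (Bn' := (sig - s ^+ 2) * ugegen (lam + 1) sig s m)
  (ep := ep)
  mu1 emu (addition_coefS mu1 m k) (addition_coefS mu1 m.+1 k) (addition_coefSr mu1 m k) _ _ _ _
  (BpE rho t) (BpE sig s).
move=> ->; first last.
- transitivity (4 * lam * (m.+1%:R + lam) * (sig - s ^+ 2) * ugegen (lam + 1) sig s m).
    by ring.
  by rewrite ugegen_raise; ring.
- transitivity (4 * lam * (m.+1%:R + lam) * (rho - t ^+ 2) * ugegen (lam + 1) rho t m).
    by ring.
  by rewrite ugegen_raise; ring.
- by rewrite ugegenSS; ring.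
- by rewrite ugegenSS; ring.
- move=> k' ek; subst k.
  have -> : lam - 1 = mu / 2 + k'%:R by rewrite /lam lamS addrK.
  have := addition_coefSr mu1 m.+1 k'.
  rewrite (_ : m.+2 + k' = (m + k'.+1).+1)%N; last by lia.
  by move=> ->; rewrite /ep; ring.
- by move=> k00; rewrite /ep k00.
rewrite (_ : prev _ k = ep * Bp rho t * Bp sig s); first by rewrite (addSn m k) -/lam; ring.
rewrite /ep /Bp; clear ki emu lk BpE Bp ep; move: ugegen => G.
case: k @lam dn => [|k] lam dn /=.
  by rewrite !mul0r.
by rewrite (_ : (m + k.+1).+1 - k = m.+2)%N; [ring | lia].
Qed.

(** The addition formula: [rho], [sig] are squared lengths of two vectors, [t], [s] their first
    coordinates and [u] the inner product of the remaining ones. Both sides satisfy the same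
    three-term recurrence in [i]. *)
Lemma zonal_addition mu rho t sig s u i K : 1 <= mu -> (i < K)%N ->
  zonal mu (rho * sig) (t * s + u) i =
  \sum_(k < K) addition_term mu i k rho t sig s *
     zonal (mu - 1) ((rho - t ^+ 2) * (sig - s ^+ 2)) u k.
Proof.
move=> mu1; have mu0 : mu != 0 by apply/eqP; lra.
have mu0' : mu + 1 != 0 by apply/eqP; lra.
elim/ltn_ind: i K => -[_|[_|i IH]] [|K] // iK.
- rewrite big_ord_recl /= big1 => [|k _]; last first.
    by rewrite /addition_term addition_coef_gt // !mul0r.
  by rewrite /addition_term /addition_coef /= subn0 fact0; field.
- case: K iK => // K _; rewrite !big_ord_recl /= big1 => [|k _]; last first.
    by rewrite /addition_term addition_coef_gt // !mul0r.
  rewrite /addition_term /addition_coef /= /rec_coef subnn subn0 (factS 0) fact0 /=.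
  rewrite [0%:R]mulr0n !mul0r.
  by rewrite muln1 /bump /= !addn0; field; rewrite mu0'.
have i0 := ler0n R i.
have nz : i.+1%:R + mu != 0 by rewrite -natr1; apply/eqP; lra.
apply: (mulfI nz); rewrite zonalSS; last lra.
rewrite (IH i.+1 _ K.+1) //; last exact: ltnW.
rewrite (IH i _ K.+1) //; last by rewrite ltnW // ltnW.
set w := (_ - _) * _; pose H := zonal (mu - 1) w u.
pose a := addition_term mu i.+1 ^~ rho ^~ t ^~ sig ^~ s.
have -> : (2 * i.+1%:R + mu) * (t * s + u) *
   (\sum_(k < K.+1) addition_term mu i.+1 k rho t sig s * zonal (mu - 1) w u k) =
  (2 * i.+1%:R + mu) * (\sum_(k < K.+1) (t * s * a k
     + prev (fun j => (1 - rec_coef mu j) * a j) k + rec_coef mu k.+1 * w * a k.+1) * H k).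
  rewrite -mulrA; congr (_ * _); rewrite mulr_sumr.
  (* [zonal_rec] turns [u * H k] into [H k.+1] and [H k.-1]. After reindexing, the boundary terms
     vanish because [rec_coef _ 0 = 0] and [a k = 0] for [k > i + 1]. *)
  transitivity (\sum_(k < K.+1) t * s * a k * H k
    + (\sum_(k < K.+1) (1 - rec_coef mu k) * a k * H k.+1
       + \sum_(k < K.+1) rec_coef mu k * w * a k * H k.-1)).
    rewrite -!big_split; apply: eq_bigr => k _ /=.
    transitivity (t * s * a k * H k + a k * (u * H k)); first by rewrite /a /H; ring.
    by rewrite /H zonal_rec //; ring.
  have aK k : (i.+1 < k)%N -> a k = 0.
    by move=> ik; rewrite /a /addition_term addition_coef_gt // !mul0r.
  have -> : \sum_(k < K.+1) (1 - rec_coef mu k) * a k * H k.+1 =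
            \sum_(k < K.+1) prev (fun j => (1 - rec_coef mu j) * a j) k * H k.
    rewrite big_ord_recr /= aK // mulr0 mul0r addr0 [RHS]big_ord_recl /= mul0r add0r.
    by apply: eq_bigr.
  have -> : \sum_(k < K.+1) rec_coef mu k * w * a k * H k.-1 =
            \sum_(k < K.+1) rec_coef mu k.+1 * w * a k.+1 * H k.
    rewrite big_ord_recl /= [in LHS]/rec_coef !mul0r add0r [RHS]big_ord_recr /=.
    by rewrite (aK K.+1) ?ltnS 1?ltnW // mulr0 mul0r addr0.
  by rewrite -!big_split; apply: eq_bigr => k _ /=; ring.
rewrite !mulr_sumr -sumrB; apply: eq_bigr => k _.
rewrite -/(H k) mulrA -(addition_term_rec i k) // mulrDl; ring.
Qed.

Lemma sum_sqr_ge0 (T : Type) (r : seq T) (g : T -> R) :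
  0 <= \sum_(a <- r) \sum_(b <- r) g a * g b.
Proof. by rewrite -big_distrlr /= -expr2 sqr_ge0. Qed.

(** * Positive definiteness of the zonal kernels *)

Fixpoint cexp (x y : R) i : R * R :=
  if i is j.+1 then let: (p, q) := cexp x y j in (x * p - y * q, x * q + y * p)
  else (1, 0).

(* In the plane the kernel is [Re ((x + iy)^n * conj (x' + iy')^n)]. *)
Lemma zonal0E x y x' y' i :
  zonal 0 ((x * x + y * y) * (x' * x' + y' * y')) (x * x' + y * y') i =
  (cexp x y i).1 * (cexp x' y' i).1 + (cexp x y i).2 * (cexp x' y' i).2.
Proof.
elim/ltn_ind: i => -[_|[_|i IH]]; [by rewrite /=; ring|by rewrite /=; ring|].
have nz : i.+1%:R + 0 != 0 :> R by rewrite addr0 pnatr_eq0.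
apply: (mulfI nz); rewrite zonalSS // !IH // /=.
by case: (cexp x y i) => p q; case: (cexp x' y' i) => p' q' /=; ring.
Qed.

Let dot n (x y : 'I_n -> R) := \sum_(j < n) x j * y j.

Let dotS n (x y : 'I_n.+1 -> R) : dot x y =
  x ord0 * y ord0 + dot (x \o lift ord0) (y \o lift ord0).
Proof. by rewrite /dot big_ord_recl. Qed.

(** Induction on the dimension by removing the first coordinate. Arbitrary weights [c] are needed
    because the [ugegen] factors of that coordinate are absorbed into them, and arbitrary lengths
    because the truncated vectors are not normalized. *)
Lemma zonal_psd p (T : Type) (r : seq T) (X : T -> 'I_p.+2 -> R) (c : T -> R) i :
  0 <= \sum_(a <- r) \sum_(b <- r) c a * c b *
    zonal p%:R (dot (X a) (X a) * dot (X b) (X b)) (dot (X a) (X b)) i.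
Proof.
elim: p i X c => [|p IH] i X c.
  pose f a := cexp (X a ord0) (X a (lift ord0 ord0)) i.
  rewrite (eq_bigr (fun a => \sum_(b <- r) (c a * (f a).1) * (c b * (f b).1) +
      \sum_(b <- r) (c a * (f a).2) * (c b * (f b).2))).
    by rewrite big_split addr_ge0 // sum_sqr_ge0.
  move=> a _; rewrite -big_split; apply: eq_bigr => b _ /=.
  by rewrite !dotS /dot !big_ord0 !addr0 zonal0E /f /=; ring.
have p1 : 1 <= p.+1%:R :> R by rewrite ler1n.
pose Y a := X a \o lift ord0; pose x a := X a ord0.
pose g k a := c a * ugegen (p.+1%:R / 2 + k%:R) (dot (X a) (X a)) (x a) (i - k).
rewrite (eq_bigr (fun a => \sum_(k < i.+1) \sum_(b <- r) addition_coef p.+1%:R i k *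
   (g k a * g k b * zonal p%:R (dot (Y a) (Y a) * dot (Y b) (Y b)) (dot (Y a) (Y b)) k))).
  rewrite exchange_big; apply: sumr_ge0 => k _ /=.
  under eq_bigr do rewrite -mulr_sumr.
  by rewrite -mulr_sumr mulr_ge0 // addition_coef_ge0.
move=> a _; rewrite exchange_big; apply: eq_bigr => b _ /=.
rewrite (dotS (X a) (X b)) (@zonal_addition _ _ _ _ _ _ i i.+1) // mulr_sumr.
apply: eq_bigr => k _; rewrite /g /addition_term.
have dotE z : dot (X z) (X z) - X z ord0 ^+ 2 = dot (Y z) (Y z).
  by rewrite dotS /Y expr2; ring.
rewrite !dotE -natr1 addrK -/(Y a) -/(Y b) -/(x a) -/(x b) natr1; ring.
Qed.

End Addition.

(** * Integrals against the weight *)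

Section FTC.
Context {R : realType}.
Notation mu := (@lebesgue_measure R).

(** Here [f] may blow up at the endpoints, as the weight does for [n = 2]. The difference [D] of [F]
    and the integral function is constant inside by the usual theorem on compact subintervals, hence
    constant up to the endpoints by continuity. *)
Lemma FTC2_oo (F f : R -> R) (a b : R) : a < b ->
  {within `[a, b], continuous F} ->
  {in `]a, b[, forall x, is_derive x (1 : R) F (f x)} ->
  {in `]a, b[, continuous f} ->
  mu.-integrable `[a, b] (EFin \o f) ->
  \int[mu]_(x in `[a, b]) f x = F b - F a.
Proof.
move=> ab cF dF cf intf.
pose J x := \int[mu]_(t in `[a, x]) f t.
have cJ := parameterized_integral_continuous (ltW ab) intf.
pose D x := J x - F x.
have cD : {within `[a, b], continuous D}.
  by move=> x; apply: cvgB; [exact: cJ|exact: cF].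
have Dcst x y : a < x -> x < y -> y < b -> D x = D y.
  move=> ax xy yb.
  have sub z : z \in `[x, y] -> z \in `]a, b[.
    by rewrite !in_itv/= => /andP[xz zy]; rewrite (lt_le_trans ax xz) (le_lt_trans zy yb).
  have sub' z : z \in `]x, y[ -> z \in `]a, b[.
    by move=> zxy; apply: sub; exact: subset_itv_oo_cc.
  have dFz z : z \in `[x, y] -> derivable F z (1 : R).
    by move=> /sub /dF [].
  have cF' z : z \in `[x, y] -> {for z, continuous F}.
    by move=> /dFz /derivable1_diffP/differentiable_continuous.
  have e : \int[mu]_(t in `[x, y]) f t = F y - F x.
    rewrite /Rintegral (@continuous_FTC2 _ f F x y) //.
    - by apply: continuous_in_subspaceT => z; rewrite inE => /sub; exact: cf.
    - split.
      + by move=> z /subset_itv_oo_cc; exact: dFz.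
      + by apply: cvg_at_right_filter; apply: cF'; rewrite in_itv/= lexx ltW.
      + by apply: cvg_at_left_filter; apply: cF'; rewrite in_itv/= lexx ltW.
    - move=> z /subset_itv_oo_cc /sub /dF [_ <-].
      by rewrite derive1E.
  have : J y - J x = F y - F x.
    rewrite /J Rintegral_itvB //.
    - rewrite Rintegral_itv_obnd_cbnd //.
      apply: integrableS intf => //; apply: subset_itv; rewrite bnd_simp; exact: ltW.
    - apply: integrableS intf => //; apply: subset_itvl; rewrite bnd_simp; exact: ltW.
    - by rewrite bnd_simp ltW.
    - by rewrite bnd_simp ltW.
  by rewrite /D; lra.
have [_ Da Db] := (continuous_within_itvP _ ab).1 cD.
pose m := (a + b) / 2.
have am : a < m by rewrite /m; lra.
have mb : m < b by rewrite /m; lra.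
have DaE : D a = D m.
  apply: (@cvg_unique _ _ (D x @[x --> a^'+])) => //.
  apply: cvg_near_cst; near=> x.
  by apply: Dcst => //; near: x; exact: nbhs_right_lt.
have DbE : D b = D m.
  apply: (@cvg_unique _ _ (D x @[x --> b^'-])) => //.
  apply: cvg_near_cst; near=> x; apply/esym.
  by apply: Dcst => //; near: x; exact: nbhs_left_gt.
have Ja : J a = 0 by rewrite /J set_itv1 Rintegral_set1.
move: DaE; rewrite -DbE /D Ja -/(J b); lra.
Unshelve. all: by end_near. Qed.

(** Monotone convergence along compact subintervals exhausting []a, b[]: the integral over each is a
    difference of two values of [F], hence at most [2 * B]. *)
Lemma integrable_oo (F f : R -> R) (a b B : R) : a < b ->
  {in `]a, b[, forall x, is_derive x (1 : R) F (f x)} ->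
  {in `]a, b[, continuous f} -> {in `]a, b[, forall x, 0 <= f x} ->
  {in `]a, b[, forall x, `|F x| <= B} ->
  mu.-integrable `]a, b[ (EFin \o f).
Proof.
move=> ab dF cf f0 FB.
have mf : measurable_fun `]a, b[ f.
  apply: open_continuous_measurable_fun; first exact: interval_open.
  by move=> x; rewrite inE; exact: cf.
apply/integrableP; split; first exact/measurable_EFinP.
rewrite [X in (X < _)%E](_ : _ = \int[mu]_(x in `]a, b[) (EFin \o f) x)%E; last first.
  by apply: eq_integral => x; rewrite inE /= => /f0 ?; rewrite ger0_norm.
(* The denominator starts at 3 so that every [I k] is nondegenerate. *)
pose d k := (b - a) / (k.+3)%:R.
have d0 k : 0 < d k by rewrite divr_gt0 ?subr_gt0.
have d2 k : d k < (b - a) / 2.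
  by rewrite ltr_pM2l ?subr_gt0 // ltf_pV2 ?posrE // ltr_nat.
have dd k : d k.+1 <= d k.
  by rewrite ler_pM2l ?subr_gt0 // lef_pV2 ?posrE // ler_nat.
pose I k := `[a + d k, b - d k]%classic.
have Isub k x : x \in `[a + d k, b - d k] -> x \in `]a, b[.
  rewrite !in_itv/= => /andP[h1 h2].
  by have := d0 k => ?; apply/andP; split; lra.
have Iab k : a + d k < b - d k by have := d2 k; lra.
have EI : `]a, b[%classic = \bigcup_k I k.
  apply/seteqP; split => [x|x [k _]]; last by move=> /Isub.
  rewrite /= in_itv/= => /andP[ax xb].
  pose e := Num.min (x - a) (b - x).
  have e0 : 0 < e by rewrite lt_min !subr_gt0 ax.
  have [k /= hk] : exists k, d k <= e.
    exists (Num.truncn ((b - a) / e)); rewrite /d ler_pdivrMr // mulrC -ler_pdivrMr //.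
    have /ltW := truncnS_gt ((b - a) / e).
    by move/le_trans; apply; rewrite ler_nat ltnW // ltnW.
  exists k => //; rewrite /I /= in_itv/=.
  by move: hk; rewrite le_min => /andP[? ?]; apply/andP; split; lra.
have Iint k : (\int[mu]_(x in I k) (EFin \o f) x <= (2 * B)%:E)%E.
  have dFz z : z \in `[a + d k, b - d k] -> derivable F z (1 : R).
    by move=> /Isub /dF [].
  have cF' z : z \in `[a + d k, b - d k] -> {for z, continuous F}.
    by move=> /dFz /derivable1_diffP/differentiable_continuous.
  have l : a + d k \in `[a + d k, b - d k] by rewrite in_itv/= lexx ltW.
  have r : b - d k \in `[a + d k, b - d k] by rewrite in_itv/= lexx ltW.
  rewrite (@continuous_FTC2 _ f F _ _ (Iab k)).
  - rewrite -EFinB lee_fin; have := FB _ (Isub _ _ l); have := FB _ (Isub _ _ r).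
    rewrite !ler_norml; lra.
  - by apply: continuous_in_subspaceT => z; rewrite inE => /Isub; exact: cf.
  - split.
    + by move=> z /subset_itv_oo_cc; exact: dFz.
    + by apply: cvg_at_right_filter; exact: cF'.
    + by apply: cvg_at_left_filter; exact: cF'.
  - move=> z /subset_itv_oo_cc /Isub /dF [_ <-].
    by rewrite derive1E.
rewrite EI; apply: (@le_lt_trans _ _ (2 * B)%:E); last exact: ltry.
have h : (\int[mu]_(x in I k) (EFin \o f) x)%E @[k --> \oo] -->
    (\int[mu]_(x in \bigcup_k I k) (EFin \o f) x)%E.
  apply: ge0_nondecreasing_set_cvg_integral.
  - apply/nondecreasing_seqP => k; rewrite subsetEset; apply: subset_itv; rewrite bnd_simp;
    by have := dd k; lra.
  - by move=> k; exact: measurable_itv.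
  - move=> k; apply/measurable_EFinP; apply: measurable_funS mf => //.
    by move=> x; exact: Isub.
  - by move=> k x /Isub /f0; rewrite lee_fin.
rewrite -(cvg_lim _ h) //; apply: lime_le; first exact: cvgP h.
exact: nearW.
Qed.

End FTC.

(** * Integrability of the weight and integration by parts *)

Section Weight.
Context {R : realType}.
Notation mu := (@lebesgue_measure R).
Variable n : nat.
Hypothesis n2 : (2 <= n)%N.
Local Notation I := (`[(-1 : R), 1]%classic).
Local Notation w := (@weight R n).
Local Notation L := (@weighted_integral R n).

Let n2R : 2 <= n%:R :> R. Proof. by rewrite ler_nat. Qed.

Lemma onem_sqr_gt0 (t : R) : t \in `](-1 : R), 1[ -> 0 < 1 - t ^+ 2.
Proof. by rewrite in_itv/= => /andP[? ?]; nra. Qed.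

Lemma weight_ge0 t : 0 <= w t. Proof. exact: powR_ge0. Qed.

Lemma measurable_weight D : measurable_fun D w.
Proof.
apply: measurable_funTS.
apply: (measurableT_comp (measurable_powR _)).
apply: continuous_measurable_fun => x.
by apply: cvgB; [exact: cvg_cst|exact: exprn_continuous].
Qed.

Lemma is_derive_powR_onem_sqr (a x : R) : x \in `](-1 : R), 1[ ->
  is_derive x (1 : R) (fun t => (1 - t ^+ 2) `^ a)
    (a * (1 - x ^+ 2) `^ (a - 1) * (- 2 * x)).
Proof.
move=> /onem_sqr_gt0 x0.
have h1 : is_derive x (1 : R) (fun t : R => 1 - t ^+ 2) (- 2 * x).
  apply: is_derive_eq; rewrite /GRing.scale /=; ring.
have h2 := is_derive1_powR a x0.
exact: (@is_derive1_comp R (fun u => u `^ a) (fun t => 1 - t ^+ 2) x _ _ h2 h1).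
Qed.

Lemma weight_continuous : {in `](-1 : R), 1[, continuous w}.
Proof.
move=> x /(is_derive_powR_onem_sqr ((n%:R - 3) / 2)) [d _].
exact/differentiable_continuous/derivable1_diffP.
Qed.

(** For [n >= 3] the weight is bounded by 1; for [n = 2] it is the derivative of the bounded
    function [asin] inside the interval. *)
Lemma weight_integrable : mu.-integrable I (EFin \o w).
Proof.
have [n3|n3] := leqP 3 n.
  apply: measurable_bounded_integrable => //.
  - exact/compact_finite_measure/segment_compact.
  - exact: measurable_weight.
  - exists 1; split; first exact: num_real.
    move=> B B1 t; rewrite /= in_itv/= => /andP[t1 t2].
    rewrite ger0_norm ?weight_ge0 // (le_trans _ (ltW B1)) //.
    have -> : 1 = 1 `^ ((n%:R - 3) / 2) :> R by rewrite powR1.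
    apply: ge0_ler_powR; rewrite ?nnegrE //.
    + by rewrite divr_ge0 // subr_ge0 ler_nat.
    + by nra.
    + by nra.
have e2 : n = 2%N by apply/eqP; rewrite eqn_leq n2 andbT -ltnS.
have ioo : mu.-integrable `](-1 : R), 1[ (EFin \o w).
  apply: (@integrable_oo _ asin _ _ _ pi) => //.
  - move=> x xI; have x0 := onem_sqr_gt0 xI.
    rewrite /weight e2 (_ : (2%:R - 3) / 2 = - 2^-1 :> R); last by field.
    rewrite powRN powR12_sqrt ?ltW //.
    by apply: is_derive1_asin; move: xI; rewrite in_itv.
  - exact: weight_continuous.
  - by move=> x _; exact: weight_ge0.
  - move=> x; rewrite in_itv/= => /andP[x1 x2].
    have xx : -1 <= x <= 1 by rewrite !ltW.
    have := asin_geNpi2 xx; have := asin_lepi2 xx; have := pi_gt0 R.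
    by rewrite ler_norml => *; apply/andP; split; lra.
apply/integrableP; split.
  by apply/measurable_EFinP; apply: measurable_weight.
rewrite (integral_itv_bndoo true false); first by have /integrableP[_] := ioo.
apply/measurable_EFinP/measurableT_comp => //.
by apply: measurable_weight.
Qed.

(** A class of integrands closed under sums and products that contains the polynomials, the
    continuous functions and the indicators of intervals. *)
Definition bdd_mfun (f : R -> R) :=
  measurable_fun I f /\ exists B : R, forall t, -1 <= t <= 1 -> `|f t| <= B.

Lemma bdd_mfun_integrable f : bdd_mfun f ->
  mu.-integrable I (EFin \o (fun t => f t * w t)).
Proof.
move=> [mf [B fB]].
have hB : mu.-integrable I (EFin \o (fun t => B * w t)).
  by have := integrableZl _ B weight_integrable; apply.
apply: (le_integrable _ _ _ hB) => //.
- apply/measurable_EFinP/measurable_funM => //.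
  by apply: measurable_weight.
- move=> t; rewrite /= in_itv/= => /fB fBt; rewrite lee_fin !normrM ler_wpM2r //.
  by rewrite (le_trans fBt) // ler_norm.
Qed.

Lemma bdd_mfun_continuous f : {within I, continuous f} -> bdd_mfun f.
Proof.
move=> cf; split.
  by apply: subspace_continuous_measurable_fun => //; exact: measurable_itv.
have := compact_bounded (continuous_compact cf (@segment_compact R (-1) 1)).
move=> [B [_ hB]]; exists (B + 1) => t tI.
by apply: (hB (B + 1)); [rewrite ltrDl|exists t; rewrite //= in_itv].
Qed.

Lemma bdd_mfun_poly (p : {poly R}) : bdd_mfun (horner p).
Proof. by apply/bdd_mfun_continuous/continuous_subspaceT/continuous_horner. Qed.

Lemma bdd_mfunD f g : bdd_mfun f -> bdd_mfun g -> bdd_mfun (fun t => f t + g t).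
Proof.
move=> [mf [A fA]] [mg [B gB]]; split; first exact: measurable_funD.
by exists (A + B) => t tI; rewrite (le_trans (ler_normD _ _)) // lerD ?fA ?gB.
Qed.

Lemma bdd_mfunM f g : bdd_mfun f -> bdd_mfun g -> bdd_mfun (fun t => f t * g t).
Proof.
move=> [mf [A fA]] [mg [B gB]]; split; first exact: measurable_funM.
by exists (A * B) => t tI; rewrite normrM ler_pM ?fA ?gB.
Qed.

Lemma bdd_mfun_cst (c : R) : bdd_mfun (fun=> c).
Proof. by split; [exact: measurable_cst|exists `|c|]. Qed.

Lemma wintD f g : bdd_mfun f -> bdd_mfun g -> L (fun t => f t + g t) = L f + L g.
Proof.
move=> nf ng; rewrite /weighted_integral -RintegralD //; try exact: bdd_mfun_integrable.
by apply: eq_Rintegral => t _; rewrite mulrDl.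
Qed.

Lemma wintZ c f : bdd_mfun f -> L (fun t => c * f t) = c * L f.
Proof.
move=> nf; rewrite /weighted_integral -RintegralZl //; last exact: bdd_mfun_integrable.
by apply: eq_Rintegral => t _; rewrite mulrA.
Qed.

Lemma wint_le f g : bdd_mfun f -> bdd_mfun g ->
  (forall t, -1 <= t <= 1 -> f t <= g t) -> L f <= L g.
Proof.
move=> nf ng fg; apply: le_Rintegral; try exact: bdd_mfun_integrable.
  exact: measurable_itv.
by move=> t; rewrite /= in_itv/= => /fg ?; rewrite ler_wpM2r ?weight_ge0.
Qed.

Lemma eq_wint f g : (forall t, f t = g t) -> L f = L g.
Proof. by move=> fg; apply: eq_Rintegral => t _; rewrite fg. Qed.

Lemma wint_sum k (F : nat -> R -> R) : (forall i, bdd_mfun (F i)) ->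
  bdd_mfun (fun t => \sum_(i < k) F i t) /\
  L (fun t => \sum_(i < k) F i t) = \sum_(i < k) L (F i).
Proof.
move=> nF; elim: k => [|k [IH1 IH2]].
  split.
    by under eq_fun do rewrite big_ord0; exact: bdd_mfun_cst.
  transitivity (L (fun=> 0 * 0)).
    by apply: eq_wint => t; rewrite big_ord0 mul0r.
  by rewrite wintZ ?mul0r ?big_ord0 //; exact: bdd_mfun_cst.
split; first by under eq_fun do rewrite big_ord_recr; exact: bdd_mfunD.
by rewrite big_ord_recr /= -IH2 -wintD //; apply: eq_wint => t; rewrite big_ord_recr.
Qed.

(** The integrand times the weight is the derivative of $p(t) (1 - t^2)^{(n-1)/2}$, which vanishes
    at both endpoints. *)
Lemma weighted_ibp (p : {poly R}) :
  L (fun t => p^`().[t] * (1 - t ^+ 2) - (n%:R - 1) * t * p.[t]) = 0.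
Proof.
have gE t : p^`().[t] * (1 - t ^+ 2) - (n%:R - 1) * t * p.[t] =
   (p^`() * (1 - 'X ^+ 2) - (n%:R - 1) *: ('X * p)).[t].
  by rewrite !(hornerE, horner_exp).
rewrite (eq_wint gE).
pose F t := p.[t] * (1 - t ^+ 2) `^ ((n%:R - 1) / 2).
have n2' := n2R; have b0 : (n%:R - 1) / 2 != 0 :> R by apply/eqP; lra.
transitivity (F 1 - F (-1)); last first.
  by rewrite /F sqrrN !expr1n subrr powR0 // !mulr0 subrr.
apply: FTC2_oo.
- by lra.
(* Continuity up to the endpoints is read off from the form $(1 - t^2)^{(n-1)/2} = \sqrt{1 -
   t^2}^{n-1}$. *)
- pose G t := p.[t] * Num.sqrt (1 - t ^+ 2) ^+ n.-1.
  have EG t : -1 <= t <= 1 -> F t = G t.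
    move=> /andP[t1 t2]; have t0 : 0 <= 1 - t ^+ 2 by nra.
    rewrite /F /G -powR12_sqrt // -(powR_mulrn n.-1 (powR_ge0 _ _)) -powRrM.
    by rewrite -subn1 natrB ?(ltnW n2) // [2^-1 * _]mulrC.
  have cG : continuous G.
    move=> t; apply: cvgM; first exact: continuous_horner.
    have c1 : {for t, continuous (fun t : R => 1 - t ^+ 2)}.
      by apply: cvgB; [exact: cvg_cst|exact: exprn_continuous].
    have c2 := continuous_comp c1 (@sqrt_continuous R _).
    exact: (continuous_comp c2 (@exprn_continuous R n.-1 _)).
  apply: (@subspace_eq_continuous _ _ _ G); last exact: continuous_subspaceT.
  by move=> t; rewrite inE /= in_itv/= => /EG.
- move=> t tI; have t0 := onem_sqr_gt0 tI.
  have d1 := is_derive_powR_onem_sqr ((n%:R - 1) / 2) tI.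
  have d2 := is_derive_poly p t.
  apply: (is_derive_eq (is_deriveM d2 d1)).
  rewrite -gE /GRing.scale /= /weight.
  rewrite (_ : (n%:R - 1) / 2 - 1 = (n%:R - 3) / 2); last by field.
  rewrite -(@mulr_powRB1 _ (1 - t ^+ 2) ((n%:R - 1) / 2)) ?ltW //; last lra.
  rewrite (_ : (n%:R - 1) / 2 - 1 = (n%:R - 3) / 2); last by field.
  by field.
- move=> t tI; apply: cvgM; last exact: weight_continuous.
  exact: continuous_horner.
- exact/bdd_mfun_integrable/bdd_mfun_poly.
Qed.
End Weight.

Lemma bdd_mfunN (R : realType) (f : R -> R) : bdd_mfun f -> bdd_mfun (fun t => - f t).
Proof.
move=> nf; have -> : (fun t => - f t) = (fun t => -1 * f t).
  by apply/funext => t; rewrite mulN1r.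
by apply: bdd_mfunM => //; exact: bdd_mfun_cst.
Qed.

Lemma bdd_mfun_id (R : realType) : bdd_mfun (fun t : R => t).
Proof.
have -> : (fun t : R => t) = horner 'X by apply/funext => t; rewrite hornerX.
exact: bdd_mfun_poly.
Qed.

Lemma bdd_mfunX (R : realType) (f : R -> R) k : bdd_mfun f -> bdd_mfun (fun t => f t ^+ k).
Proof.
move=> nf; elim: k => [|k IH]; first exact: bdd_mfun_cst.
have -> : (fun t => f t ^+ k.+1) = (fun t => f t * f t ^+ k).
  by apply/funext => t; rewrite exprS.
exact: bdd_mfunM.
Qed.

Ltac bdd := repeat first
  [ assumption | exact: bdd_mfun_cst | exact: bdd_mfun_id | exact: bdd_mfun_poly
  | match goal with
    | |- bdd_mfun (fun t => - @?f t) => apply: (@bdd_mfunN _ f)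
    | |- bdd_mfun (fun t => @?f t * @?g t) => apply: (@bdd_mfunM _ f g)
    | |- bdd_mfun (fun t => @?f t + @?g t) => apply: (@bdd_mfunD _ f g)
    | |- bdd_mfun (fun t => @?f t ^+ ?k) => apply: (@bdd_mfunX _ f k)
    end ].

(** * Orthogonality of the Gegenbauer polynomials *)

Section Gegenbauer.
Context {R : realType}.
Variable n : nat.
Hypothesis n2 : (2 <= n)%N.
Local Notation I := (`[(-1 : R), 1]%classic).
Local Notation w := (@weight R n).
Local Notation L := (@weighted_integral R n).
Local Notation P := (@gegenbauer R n).
Local Notation kap := (rec_coef (n%:R - 1 : R)).

Lemma nm1_ge1 : 1 <= n%:R - 1 :> R.
Proof. by have : 2%:R <= n%:R :> R by [rewrite ler_nat]; lra. Qed.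

Lemma gegenbauer_zonal i t : (P i).[t] = zonal (n%:R - 2) 1 t i.
Proof.
elim/ltn_ind: i => -[_|[_|i IH]]; rewrite ?hornerC ?hornerX //.
rewrite [P _]/= [RHS]/= -/(P i.+1) -/(zonal _ _ _ i.+1).
rewrite hornerZ hornerD hornerN !hornerZ hornerM hornerX !IH //.
by rewrite mul1r !addrA.
Qed.

Lemma gegenbauer_rec k t :
  t * (P k).[t] = (1 - kap k) * (P k.+1).[t] + kap k * (P k.-1).[t].
Proof.
rewrite !gegenbauer_zonal (_ : n%:R - 2 = n%:R - 1 - 1); last by ring.
by rewrite zonal_rec ?nm1_ge1 // mulr1.
Qed.

Lemma gegenbauerSS i t :
  (i.+1%:R + (n%:R - 2)) * (P i.+2).[t] =
  (2 * i.+1%:R + (n%:R - 2)) * t * (P i.+1).[t] - i.+1%:R * (P i).[t].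
Proof.
rewrite !gegenbauer_zonal zonalSS ?mulr1 //.
by have := nm1_ge1; lra.
Qed.

Lemma gegenbauer_deriv i t : (1 - t ^+ 2) * (P i.+1)^`().[t] =
  i.+1%:R * ((P i).[t] - t * (P i.+1).[t]).
Proof.
have nu0 := nm1_ge1; set nu : R := n%:R - 2.
have dSS j : (j.+1%:R + nu) * (P j.+2)^`().[t] =
    (2 * j.+1%:R + nu) * ((P j.+1).[t] + t * (P j.+1)^`().[t])
    - j.+1%:R * (P j)^`().[t].
  have j0 := ler0n R j.
  have nz : j.+1%:R + n%:R - 2 != 0 :> R by rewrite -natr1; apply/eqP; lra.
  rewrite [P j.+2]/= -/(P j.+1) derivZ derivB !derivZ derivM derivX.
  rewrite hornerZ hornerD hornerN !hornerZ hornerD !hornerM hornerX hornerC.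
  by rewrite {1}/nu addrA mulVKf // /nu; ring.
(* The differentiated recurrence involves the derivatives of two consecutive polynomials, so the
   induction carries a companion formula for [P i]. *)
suff [] : (1 - t ^+ 2) * (P i.+1)^`().[t] =
  i.+1%:R * ((P i).[t] - t * (P i.+1).[t]) /\
  (1 - t ^+ 2) * (P i)^`().[t] = (i%:R + nu) * (t * (P i).[t] - (P i.+1).[t]) by [].
elim: i => [|i [IH1 IH2]].
  by split; rewrite /= ?derivX ?derivC !hornerE; ring.
have i0 := ler0n R i.
have nz : i.+1%:R + nu != 0 :> R by rewrite -natr1 /nu; apply/eqP; lra.
have e := gegenbauerSS i t; rewrite -/nu in e.
split; last first.
  rewrite IH1 mulrBr.
  have -> : i.+1%:R * (P i).[t] =
      (2 * i.+1%:R + nu) * t * (P i.+1).[t] - (i.+1%:R + nu) * (P i.+2).[t].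
    by rewrite e; ring.
  by ring.
apply: (mulfI nz).
transitivity ((1 - t ^+ 2) * ((i.+1%:R + nu) * (P i.+2)^`().[t])); first by ring.
rewrite dSS.
transitivity ((2 * i.+1%:R + nu) * ((1 - t ^+ 2) * (P i.+1).[t] +
  t * ((1 - t ^+ 2) * (P i.+1)^`().[t])) - i.+1%:R * ((1 - t ^+ 2) * (P i)^`().[t])).
  by ring.
rewrite IH1 IH2.
transitivity (i.+2%:R * ((i.+1%:R + nu) * (P i.+1).[t]
    - t * ((i.+1%:R + nu) * (P i.+2).[t]))).
  by rewrite e -!natr1; ring.
by ring.
Qed.

Lemma wint_lin a b F G : bdd_mfun F -> bdd_mfun G ->
  L (fun t => a * F t + b * G t) = a * L F + b * L G.
Proof.
move=> nF nG; rewrite -!(wintZ n2) // (wintD n2) //; first by bdd.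
by bdd.
Qed.

(** Integration by parts applied to [P i.+1] and the three-term recurrence give two linear
    relations; together they express the integral of [P i.+2] through [i%:R] times that of
    [t * P i.+1]. *)
Lemma wint_gegenbauer i : L (fun t => (P i.+1).[t]) = 0.
Proof.
have nu0 := nm1_ge1.
elim/ltn_ind: i => -[_|i IH].
  have := weighted_ibp n2 (1 : {poly R}).
  rewrite (@eq_wint _ _ _ (fun t => (1 - n%:R) * (P 1).[t])) => [|t].
    rewrite (wintZ n2) //; last exact: bdd_mfun_poly.
    by move=> /eqP; rewrite mulf_eq0 => /orP[/eqP|/eqP //]; lra.
  by rewrite derivC !hornerE; ring.
have i0 := ler0n R i.
have := weighted_ibp n2 (P i.+1).
rewrite (@eq_wint _ _ _ (fun t => i.+1%:R * (P i).[t]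
    + - (i%:R + n%:R) * (t * (P i.+1).[t]))) => [|t]; last first.
  by rewrite mulrC gegenbauer_deriv -!natr1; ring.
rewrite wint_lin; [|by bdd|by bdd] => e1.
have e2 : (i.+1%:R + (n%:R - 2)) * L (fun t => (P i.+2).[t]) =
    (2 * i.+1%:R + (n%:R - 2)) * L (fun t => t * (P i.+1).[t])
    + - i.+1%:R * L (fun t => (P i).[t]).
  rewrite -(wintZ n2); last by bdd.
  rewrite -wint_lin; [|by bdd|by bdd].
  by apply: eq_wint => t; rewrite gegenbauerSS; ring.
have e3 : (i.+1%:R + (n%:R - 2)) * L (fun t => (P i.+2).[t]) =
    i%:R * L (fun t => t * (P i.+1).[t]).
  by rewrite e2 -natr1; move: e1; rewrite -natr1; lra.
(* For [i = 0] the factor [i%:R] vanishes, although the integral of [P 0] does not; for [i > 0] the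
   induction hypothesis enters [e1]. *)
have e4 : i%:R * L (fun t => t * (P i.+1).[t]) = 0.
  clear e2 e3; case: i IH i0 e1 => [|i] IH i0 e1; first by rewrite mul0r.
  move: e1; rewrite (IH i) // mulr0 add0r => /eqP; rewrite mulf_eq0 => /orP[/eqP|/eqP ->].
    by lra.
  by rewrite mulr0.
move/eqP: e3; rewrite e4 mulf_eq0 => /orP[/eqP|/eqP //].
by rewrite -natr1; lra.
Qed.

(** Induction on the smaller index: [P i.+1] is replaced through [t * P i], and the factor [t] is
    moved onto [P j]. Only pairs with smaller index [i] or [i.-1] remain. *)
Lemma gegenbauer_orth i j : (i < j)%N -> L (fun t => (P i).[t] * (P j).[t]) = 0.
Proof.
elim/ltn_ind: i j => -[_|i IH] j ij.
  case: j ij => // j _; rewrite -(wint_gegenbauer j); apply: eq_wint => t.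
  by rewrite hornerC mul1r.
have k1 : 1 - kap i != 0 by rewrite subr_eq0 gt_eqF // rec_coef_lt1 // nm1_ge1.
apply: (mulfI k1); rewrite mulr0.
transitivity (L (fun t => 1 * (1 - kap j) * ((P i).[t] * (P j.+1).[t])
   + kap j * ((P i).[t] * (P j.-1).[t])) + - kap i * L (fun t => (P i.-1).[t] * (P j).[t])).
  rewrite -!(wintZ n2); [|by bdd|by bdd].
  rewrite -(wintD n2); [|by bdd|by bdd].
  apply: eq_wint => t.
  have := gegenbauer_rec i t; have := gegenbauer_rec j t => ej ei.
  transitivity ((P i).[t] * (t * (P j).[t]) - kap i * (P i.-1).[t] * (P j).[t]).
    have -> : (P i).[t] * (t * (P j).[t]) = (t * (P i).[t]) * (P j).[t] by ring.
    by rewrite ei; ring.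
  by rewrite ej; ring.
rewrite wint_lin; [|by bdd|by bdd].
rewrite (IH i _ j.+1) ?(IH i _ j.-1) //; try by lia.
case: i ij {IH k1} (IH i.-1) => [|i] ij IH.
  by rewrite /rec_coef mul0r; ring.
by rewrite (IH _ j) ?mulr0 ?addr0 //=; lia.
Qed.

End Gegenbauer.

(** * Concentration and the Gegenbauer expansion *)

Section Positivity.
Context {R : realType}.
Notation mu := (@lebesgue_measure R).
Variable n : nat.
Hypothesis n2 : (2 <= n)%N.
Local Notation I := (`[(-1 : R), 1]%classic).
Local Notation w := (@weight R n).
Local Notation L := (@weighted_integral R n).
Local Notation P := (@gegenbauer R n).
Local Notation kap := (rec_coef (n%:R - 1 : R)).

Lemma bdd_mfun_indic c d : bdd_mfun (\1_`[c, d] : R -> R).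
Proof.
split; first exact: measurable_indic.
by exists 1 => t _; rewrite indicE; case: (_ \in _); rewrite ?normr1 ?normr0.
Qed.

Lemma wint_indic_gt0 (c d : R) : -1 < c -> c < d -> d < 1 -> 0 < L (\1_`[c, d]).
Proof.
move=> c1 cd d1.
have sub x : x \in `[c, d] -> x \in `](-1 : R), 1[.
  by rewrite !in_itv/= => /andP[cx xd]; rewrite (lt_le_trans c1 cx) (le_lt_trans xd d1).
have cw : {within `[c, d], continuous w}.
  by apply: continuous_in_subspaceT => x; rewrite inE => /sub; exact: weight_continuous.
have [x0 x0I hmin] := EVT_min (ltW cd) cw.
have wx0 : 0 < w x0 by apply/powR_gt0/onem_sqr_gt0/sub.
apply: (@lt_le_trans _ _ (\int[mu]_(t in `[c, d]) w x0)).
  rewrite Rintegral_cst //= lebesgue_measure_itv/= lte_fin cd -EFinB /=.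
  by rewrite mulr_gt0 // subr_gt0.
rewrite (_ : L _ = \int[mu]_(t in `[c, d]) w t).
  apply: le_Rintegral => //.
  - by apply: continuous_compact_integrable; [exact: segment_compact|move=> x; exact: cvg_cst].
  - by apply: continuous_compact_integrable; [exact: segment_compact|].
rewrite /weighted_integral.
transitivity (\int[mu]_(t in I) (w \_ `[c, d]) t).
  apply: eq_Rintegral => t _; rewrite /= patchE indicE.
  by case: (_ \in _); rewrite ?mul1r ?mul0r.
rewrite -Rintegral_mkcondr; congr Rintegral.
rewrite setIidr // => x /= /sub; exact: subset_itv_oo_cc.
Qed.

Lemma wint1_gt0 : 0 < L (fun=> 1).
Proof.
have h : 0 < L (\1_`[-2^-1, 2^-1]) by apply: wint_indic_gt0; lra.
apply: (lt_le_trans h); apply: (wint_le n2); [exact: bdd_mfun_indic|exact: bdd_mfun_cst|] => t _.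
by rewrite indicE lern1; case: (_ \in _).
Qed.

(** Evaluating the integral of [t * P i * P i.+1] by the recurrence for either factor shows that
    consecutive squared norms have a positive ratio. *)
Lemma gegenbauer_norm_gt0 i : 0 < L (fun t => (P i).[t] ^+ 2).
Proof.
elim: i => [|i IH].
  by rewrite (@eq_wint _ _ _ (fun=> 1)) ?wint1_gt0 // => t; rewrite hornerC expr1n.
have k1 : 0 < 1 - kap i by rewrite subr_gt0 rec_coef_lt1 // nm1_ge1.
have k2 : 0 < kap i.+1.
  have := @nm1_ge1 R n n2; have i0 := ler0n R i.
  by move=> h; rewrite /rec_coef divr_gt0 // -natr1; lra.
rewrite -(pmulr_rgt0 _ k1).
suff -> : (1 - kap i) * L (fun t => (P i.+1).[t] ^+ 2) = kap i.+1 * L (fun t => (P i).[t] ^+ 2).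
  exact: mulr_gt0.
have e t : (P i.+1).[t] * (t * (P i).[t]) = (P i).[t] * (t * (P i.+1).[t]) by ring.
have := eq_wint n e.
rewrite (@eq_wint _ _ _ (fun t => (1 - kap i) * ((P i.+1).[t] ^+ 2)
  + kap i * ((P i.-1).[t] * (P i.+1).[t]))) => [|t]; last first.
  by rewrite (gegenbauer_rec n2); ring.
rewrite (wint_lin n2); [|by bdd|by bdd].
rewrite (@gegenbauer_orth _ _ n2 i.-1 i.+1) ?mulr0 ?addr0; last by lia.
move=> ->.
rewrite (@eq_wint _ _ _ (fun t => (1 - kap i.+1) * ((P i).[t] * (P i.+2).[t])
  + kap i.+1 * ((P i).[t] ^+ 2))) => [|t]; last first.
  by rewrite (gegenbauer_rec n2); ring.
rewrite (wint_lin n2); [|by bdd|by bdd].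
by rewrite (@gegenbauer_orth _ _ n2 i i.+2) // mulr0 add0r.
Qed.

(* Against the measure [q^m w], whose mass concentrates at the peak [t0] of [q]
   as [m] grows, the average of [psi] tends to [psi t0]. *)
Lemma concentration (psi q : R -> R) (t0 : R) :
  {within I, continuous psi} -> bdd_mfun q -> -1 <= t0 <= 1 ->
  (forall t, -1 <= t <= 1 -> 0 <= q t) ->
  (forall t t', -1 <= t <= 1 -> -1 <= t' <= 1 ->
     `|t - t0| < `|t' - t0| -> q t' < q t) ->
  (forall m, L (fun t => psi t * q t ^+ m) <= 0) -> psi t0 <= 0.
Proof.
move=> cpsi nq /andP[t01 t02] q0 qmon hL; rewrite leNgt; apply/negP => p0.
pose de := psi t0 / 2.
have de0 : 0 < de by rewrite divr_gt0.
have [eta eta0 heta] : exists2 eta : R, 0 < eta &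
    forall t, -1 <= t <= 1 -> `|t - t0| < eta -> de <= psi t.
  have t0I : I t0 by rewrite /= in_itv/= t01.
  have := (@subspace_continuousP _ _ _ _).1 cpsi _ t0I.
  move=> /cvgrPdist_le /(_ _ de0); rewrite near_withinE near_simpl => -[e /= e0 he].
  exists e => // t tI tt0.
  have := he t; rewrite /ball_ /= distrC => /(_ tt0) /=; rewrite in_itv/= => /(_ tI).
  rewrite -[from_subspace _ _ t0]/(psi t0) -[from_subspace _ _ t]/(psi t).
  by rewrite ler_norml /de => /andP[? ?]; lra.
pose et := Num.min eta 1.
have et0 : 0 < et by rewrite lt_min eta0 ltr01.
have et1 : et <= 1 by rewrite ge_min lexx orbT.
have ete : et <= eta by rewrite ge_min lexx.
(* A direction in which one can move from [t0] by any distance less than 1 and stay inside the open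
   interval, even if [t0] is an endpoint. *)
pose sg : R := if t0 <= 0 then 1 else -1.
have sgt r : 0 < r -> r < et -> -1 < t0 + sg * r < 1.
  by rewrite /sg; case: (lerP t0 0) => /= ? ? ?; apply/andP; split; lra.
have sgn r : 0 < r -> `|t0 + sg * r - t0| = r.
  move=> r0; rewrite addrC addKr normrM (gtr0_norm r0) /sg.
  by case: ifP => _; rewrite ?normrN normr1 mul1r.
have [/andP[a1 a2] /andP[b1 b2]] :
    -1 < t0 + sg * (et / 3) < 1 /\ -1 < t0 + sg * (2 * et / 3) < 1.
  by split; apply: sgt; lra.
have I2 : -1 <= t0 + sg * (et / 3) <= 1 by rewrite !ltW.
have I1 : -1 <= t0 + sg * (2 * et / 3) <= 1 by rewrite !ltW.
have e2 : `|t0 + sg * (et / 3) - t0| = et / 3 by apply: sgn; lra.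
have e1 : `|t0 + sg * (2 * et / 3) - t0| = 2 * et / 3 by apply: sgn; lra.
pose a := q (t0 + sg * (et / 3)); pose b := q (t0 + sg * (2 * et / 3)).
have b0 : 0 <= b by apply: q0; rewrite !ltW.
have ab : b < a.
  by apply: qmon; rewrite // e1 e2; lra.
(* The interval between the distances [et / 6] and [et / 4] from [t0]; on it [q] exceeds [a]. *)
have [c [d [c1 cd d1 hV]]] : exists c d, [/\ -1 < c, c < d, d < 1 &
    forall t, t \in `[c, d] -> `|t - t0| < et / 3].
  exists (Num.min (t0 + sg * (et / 4)) (t0 + sg * (et / 6))).
  exists (Num.max (t0 + sg * (et / 4)) (t0 + sg * (et / 6))).
  have h4 := sgt (et / 4) ltac:(lra) ltac:(lra).
  have h6 := sgt (et / 6) ltac:(lra) ltac:(lra).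
  move: h4 h6 => /andP[h4 h4'] /andP[h6 h6'].
  split; [by rewrite lt_min h4|by rewrite /sg; case: ifP => _;
    rewrite lt_max !gt_min; lra|by rewrite gt_max h4'|].
  move=> t; rewrite in_itv/= ge_min le_max ltr_norml /sg; case: ifP => _; lra.
pose V : R -> R := \1_`[c, d].
have LV : 0 < L V by exact: wint_indic_gt0.
have npsi := bdd_mfun_continuous cpsi.
have [_ [B hB]] := npsi.
have B0 : 0 <= B.
  by apply: le_trans (hB 0 _) => //; apply/andP; split; lra.
(* Pointwise [psi * q ^+ m >= de * a ^+ m * V - B * b ^+ m]: within distance [et] of [t0] both
   [psi >= de] and [q >= 0] hold, and farther away [q <= b]. As [b < a], large [m] gives a
   contradiction. *)
have key m : de * a ^+ m * L V <= B * b ^+ m * L (fun=> 1).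
  have a0 : 0 <= a by apply: ltW; exact: le_lt_trans ab.
  have nV : bdd_mfun V by exact: bdd_mfun_indic.
  rewrite -subr_le0; apply: le_trans (hL m).
  rewrite -mulNr -(wint_lin n2) //; last exact: bdd_mfun_cst.
  apply: (wint_le n2); [by bdd|by bdd|] => t tI; rewrite mulr1.
  have Bb : 0 <= B * b ^+ m by rewrite mulr_ge0 // exprn_ge0.
  have [tet|tet] := ltP `|t - t0| et.
    have pt : de <= psi t by apply: heta => //; exact: lt_le_trans ete.
    have pt0 : 0 <= psi t * q t ^+ m.
      by rewrite mulr_ge0 ?exprn_ge0 ?q0 // (le_trans _ pt) // ltW.
    rewrite /V indicE; case: (boolP (t \in _)) => [|_]; last by rewrite mulr0; lra.
    rewrite inE /= => /hV ht; rewrite mulr1.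
    have : de * a ^+ m <= psi t * q t ^+ m; last by lra.
    rewrite ler_pM ?exprn_ge0 ?(ltW de0) // lerXn2r ?nnegrE ?(q0 _ tI) //.
    by apply/ltW/qmon => //; rewrite e2.
  have qb : q t <= b by apply/ltW/qmon => //; rewrite e1; lra.
  rewrite /V indicE; case: (boolP (t \in _)) => [|_].
    by rewrite inE /= => /hV ht; lra.
  rewrite mulr0 add0r lerNl -mulNr.
  apply: le_trans (ler_norm _) _; rewrite normrM normrN.
  by rewrite ler_pM // ?hB // ger0_norm ?exprn_ge0 ?(q0 _ tI) // lerXn2r ?nnegrE ?(q0 _ tI).
have a0 : 0 < a by exact: le_lt_trans ab.
pose r := b / a.
have r1 : `|r| < 1 by rewrite /r ger0_norm ?divr_ge0 // ?(ltW a0) // ltr_pdivrMr // mul1r.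
have keyr m : de * L V <= B * L (fun=> 1) * r ^+ m.
  have am : 0 < a ^+ m by rewrite exprn_gt0.
  rewrite /r expr_div_n mulrA ler_pdivlMr //.
  by have := key m; lra.
have lim0 : (fun m => B * L (fun=> 1) * r ^+ m) @ \oo --> B * L (fun=> 1) * 0.
  by apply: cvgM; [exact: cvg_cst|exact: cvg_expr].
have : de * L V <= B * L (fun=> 1) * 0.
  by rewrite -(cvg_lim _ lim0) //; apply: limr_ge; [exact: cvgP lim0|exact: nearW].
by rewrite mulr0 leNgt mulr_gt0.
Qed.

End Positivity.

Section Psd.
Context {R : realType}.
Variable n : nat.
Hypothesis n2 : (2 <= n)%N.
Local Notation I := (`[(-1 : R), 1]%classic).
Local Notation w := (@weight R n).
Local Notation L := (@weighted_integral R n).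
Local Notation P := (@gegenbauer R n).
Local Notation kap := (rec_coef (n%:R - 1 : R)).

Lemma gegenbauer_psd (T : eqType) (r : seq T) (X : T -> 'rV[R]_n) (c : T -> R) i :
  {in r, forall a, inner (X a) (X a) = 1} ->
  0 <= \sum_(a <- r) \sum_(b <- r) c a * c b * (P i).[inner (X a) (X b)].
Proof.
move=> X1.
case: n n2 X X1 => [|[|p]] // _ X X1.
apply: le_trans (zonal_psd r (fun a j => X a 0 j) c i) _.
rewrite le_eqVlt; apply/orP; left; apply/eqP.
apply: eq_big_seq => a ar; apply: eq_big_seq => b br; rewrite gegenbauer_zonal.
have -> : p.+2%:R - 2 = p%:R :> R by rewrite -!natr1; ring.
have e z : z \in r -> \sum_(j < p.+2) X z 0 j * X z 0 j = 1 by exact: X1.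
by rewrite !e // mul1r.
Qed.

Lemma gegenbauer_at1 i : (P i).[1] = 1.
Proof.
elim/ltn_ind: i => -[_|i IH]; first by rewrite hornerC.
have k1 : 1 - kap i != 0 by rewrite subr_eq0 gt_eqF // rec_coef_lt1 // nm1_ge1.
apply: (mulfI k1); have := gegenbauer_rec n2 i (1 : R).
rewrite (IH i) // (IH i.-1); last by lia.
by lra.
Qed.

End Psd.

Section Expansion.
Context {R : realType}.
Variable n : nat.
Hypothesis n2 : (2 <= n)%N.
Local Notation I := (`[(-1 : R), 1]%classic).
Local Notation w := (@weight R n).
Local Notation L := (@weighted_integral R n).
Local Notation P := (@gegenbauer R n).

(** Positive definiteness for two unit vectors with inner product [t], with weights 1 and [s = 1] or
    [s = -1]. *)
Lemma gegenbauer_le1 i t : -1 <= t <= 1 -> `|(P i).[t]| <= 1.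
Proof.
move=> /andP[t1 t2].
case: n n2 => [|[|p]] // n2'.
pose v (b : bool) : 'rV[R]_p.+2 := \row_j (if j == ord0 then (if b then 1 else t)
  else if j == lift ord0 ord0 then (if b then 0 else Num.sqrt (1 - t ^+ 2)) else 0).
have vE b b' : inner (v b) (v b') = v b 0 ord0 * v b' 0 ord0 +
    v b 0 (lift ord0 ord0) * v b' 0 (lift ord0 ord0).
  rewrite /inner !big_ord_recl big1 ?addr0 // => j _.
  by rewrite !mxE /= mul0r.
have t0 : 0 <= 1 - t ^+ 2 by nra.
have v1 b : inner (v b) (v b) = 1.
  rewrite vE !mxE /=; case: b; first by ring.
  by rewrite -[Num.sqrt _ * _]expr2 sqr_sqrtr //; ring.
have v12 : inner (v true) (v false) = t by rewrite vE !mxE /=; ring.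
have v21 : inner (v false) (v true) = t by rewrite vE !mxE /=; ring.
have key (s : R) : s * s = 1 -> 0 <= 2 + 2 * s * (gegenbauer p.+2 i).[t].
  move=> s1.
  have := gegenbauer_psd n2' (r := [:: true; false]) (fun b => if b then 1 else s) i (in1W v1).
  rewrite !big_cons !big_nil !v1 v12 v21 (gegenbauer_at1 n2') s1; lra.
rewrite ler_norml; have := key 1; have := key (-1).
rewrite mulrNN mulr1 => /(_ erefl) h1 /(_ erefl) h2; lra.
Qed.

(** * Uniform convergence of the Gegenbauer expansion *)

Variable f : R -> R.
Local Notation c := (gegenbauer_coef n f).
Hypothesis cf : {within I, continuous f}.
Hypothesis c0 : forall i, (0 < i)%N -> c i <= 0.

Let nf : bdd_mfun f. Proof. exact: bdd_mfun_continuous. Qed.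

Definition gegenbauer_psum N t := \sum_(i < N) c i * (P i).[t].

Let nS N : bdd_mfun (gegenbauer_psum N).
Proof. by apply: (wint_sum n2 N (F := fun i t => c i * (P i).[t]) _).1 => i; bdd. Qed.

Let nR N : bdd_mfun (fun t => f t - gegenbauer_psum N t).
Proof. by bdd; exact: nS. Qed.

Let continuous_psum N : continuous (gegenbauer_psum N).
Proof.
have -> : gegenbauer_psum N = horner (\sum_(i < N) c i *: P i).
  by apply/funext => t; rewrite horner_sum; apply: eq_bigr => i _; rewrite hornerZ.
exact: continuous_horner.
Qed.

Let cR N : {within I, continuous (fun t => f t - gegenbauer_psum N t)}.
Proof.
by move=> t; apply: cvgB; [exact: cf|exact: (continuous_subspaceT (@continuous_psum N))].
Qed.

Lemma gegenbauer_orthC i j : i != j -> L (fun t => (P i).[t] * (P j).[t]) = 0.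
Proof.
rewrite neq_ltn => /orP[|] ij; first exact: gegenbauer_orth.
by rewrite -(gegenbauer_orth n2 ij); apply: eq_wint => t; rewrite mulrC.
Qed.

Lemma wint_coef j : L (fun t => f t * (P j).[t]) = c j * L (fun t => (P j).[t] ^+ 2).
Proof. by rewrite /gegenbauer_coef divfK // gt_eqF // gegenbauer_norm_gt0. Qed.

Lemma wint_remainder N j : L (fun t => (f t - gegenbauer_psum N t) * (P j).[t]) =
  if (j < N)%N then 0 else c j * L (fun t => (P j).[t] ^+ 2).
Proof.
rewrite (@eq_wint _ _ _ (fun t => 1 * (f t * (P j).[t])
    + -1 * (\sum_(i < N) c i * ((P i).[t] * (P j).[t])))); last first.
  move=> t; rewrite mulrBl mul1r mulN1r; congr (_ - _).
  by rewrite /gegenbauer_psum mulr_suml; apply: eq_bigr => i _; rewrite mulrA.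
have [nF eF] : bdd_mfun (fun t => \sum_(i < N) c i * ((P i).[t] * (P j).[t])) /\
    L (fun t => \sum_(i < N) c i * ((P i).[t] * (P j).[t])) =
    if (j < N)%N then c j * L (fun t => (P j).[t] ^+ 2) else 0.
  pose F i t := c i * ((P i).[t] * (P j).[t]).
  have nF i : bdd_mfun (F i) by rewrite /F; bdd.
  have [h1 e1] := wint_sum n2 N nF.
  split => //; apply: (etrans e1); rewrite /F; case: ltnP => jN.
    rewrite (bigD1 (Ordinal jN)) //= big1 ?addr0 => [|i ij].
      by rewrite (wintZ n2); [congr (_ * _); apply: eq_wint => t; rewrite expr2|by bdd].
    by rewrite (wintZ n2) ?gegenbauer_orthC ?mulr0 //; bdd.
  rewrite big1 // => i _; rewrite (wintZ n2) ?gegenbauer_orthC ?mulr0 //; last by bdd.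
  by rewrite neq_ltn (leq_trans (ltn_ord i) jN).
rewrite (wint_lin n2) // ?eF; last by bdd.
by rewrite wint_coef; case: ifP => _; ring.
Qed.

Lemma wint_low_degree phi N (p : {poly R}) : bdd_mfun phi ->
  (forall j, (j < N)%N -> L (fun t => phi t * (P j).[t]) = 0) ->
  (size p <= N)%N -> L (fun t => phi t * p.[t]) = 0.
Proof.
move=> nphi phi0 pN.
(* Each factor [t] moves [j] by at most one, so [t ^+ m * P j] involves only polynomials of index at
   most [m + j]. *)
have XP m j : (m + j < N)%N -> L (fun t => phi t * (t ^+ m * (P j).[t])) = 0.
  elim: m j => [|m IH] j mj.
    by rewrite -(phi0 j mj); apply: eq_wint => t; rewrite mul1r.
  rewrite (@eq_wint _ _ _ (fun t => (1 - rec_coef (n%:R - 1) j) * (phi t * (t ^+ m * (P j.+1).[t]))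
      + rec_coef (n%:R - 1) j * (phi t * (t ^+ m * (P j.-1).[t])))) => [|t].
    rewrite (wint_lin n2); [|by bdd|by bdd].
    by rewrite !IH ?mulr0 ?addr0 //; lia.
  transitivity (phi t * (t ^+ m * (t * (P j).[t]))); first by rewrite exprS; ring.
  by rewrite (gegenbauer_rec n2); ring.
rewrite (@eq_wint _ _ _ (fun t => \sum_(i < size p)
    p`_i * (phi t * (t ^+ i * (P 0).[t])))) => [|t].
  pose F i t := p`_i * (phi t * (t ^+ i * (P 0).[t])).
  have nF i : bdd_mfun (F i) by rewrite /F; bdd.
  have [_ e1] := wint_sum n2 (size p) nF; apply: (etrans e1); rewrite /F.
  rewrite big1 // => i _; rewrite (wintZ n2); last by bdd.
  by rewrite XP ?mulr0 // addn0 (leq_trans (ltn_ord i) pN).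
rewrite horner_coef mulr_sumr; apply: eq_bigr => i _.
by rewrite hornerC mulr1; ring.
Qed.

(* Multiplication by [(1 + t) / 2] preserves the cone of nonnegative Gegenbauer
   combinations, on which [phi |-> L ((f - gegenbauer_psum N) * phi)] is
   nonpositive. *)
Lemma psum_at1_ge N : (0 < N)%N -> f 1 <= gegenbauer_psum N 1.
Proof.
move=> N0; rewrite -subr_le0.
pose q (t : R) := (1 + t) / 2.
have nq : bdd_mfun q by rewrite /q; bdd.
apply: (concentration n2 (psi := fun t => f t - gegenbauer_psum N t) (q := q) (t0 := 1)) => //.
- by apply/andP; split; lra.
- by move=> t /andP[t1 _]; rewrite /q; lra.
- move=> t t' /andP[t1 t2] /andP[t3 t4].
  by rewrite !ler0_norm /q ?subr_le0 //; lra.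
move=> m.
suff key j : L (fun t => (f t - gegenbauer_psum N t) * (q t ^+ m * (P j).[t])) <= 0.
  apply: le_trans (key 0%N); rewrite le_eqVlt; apply/orP; left; apply/eqP.
  by apply: eq_wint => t; rewrite hornerC mulr1.
have nRN := nR N.
elim: m j => [|m IH] j.
  rewrite (@eq_wint _ _ _ (fun t => (f t - gegenbauer_psum N t) * (P j).[t])) => [|t].
    (* Indices below [N] contribute 0; from [N] on the coefficient is nonpositive, since [N > 0]
       excludes [c 0]. *)
    rewrite wint_remainder; case: ltnP => // Nj.
    by rewrite mulr_le0_ge0 ?c0 ?(leq_trans N0) // ltW // gegenbauer_norm_gt0.
  by rewrite mul1r.
have k0 : 0 <= rec_coef (n%:R - 1) j :> R.
  have := @nm1_ge1 R n n2; have j0 := ler0n R j => n1.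
  case: j j0 {IH} => [|j] j0; first by rewrite /rec_coef mul0r.
  by rewrite /rec_coef divr_ge0 //; rewrite -natr1 in j0 *; have := ler0n R j; lra.
have k1 : rec_coef (n%:R - 1) j < 1 :> R by rewrite rec_coef_lt1 // nm1_ge1.
rewrite (@eq_wint _ _ _ (fun t => 2^-1 * ((f t - gegenbauer_psum N t) * (q t ^+ m * (P j).[t])) +
   2^-1 * ((1 - rec_coef (n%:R - 1) j) * ((f t - gegenbauer_psum N t) * (q t ^+ m * (P j.+1).[t]))
      + rec_coef (n%:R - 1) j * ((f t - gegenbauer_psum N t) * (q t ^+ m * (P j.-1).[t]))))) => [|t].
  rewrite !(wint_lin n2); try by bdd.
  have := IH j; have := IH j.+1; have := IH j.-1.
  by move=> h1 h2 h3; nra.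
transitivity (2^-1 * ((f t - gegenbauer_psum N t) * (q t ^+ m * (P j).[t])) +
   2^-1 * ((f t - gegenbauer_psum N t) * (q t ^+ m * (t * (P j).[t])))).
  by rewrite exprS {1}/q; field.
by rewrite (gegenbauer_rec n2); ring.
Qed.

(** For [i >= 1] one has $|c_i P_i(t)| \le -c_i$, and $-c_i$ is the decrease of the partial sums at
    1, where every $P_i$ equals 1. *)
Lemma psum_dist N k t : (0 < N)%N -> (N <= k)%N -> -1 <= t <= 1 ->
  `|gegenbauer_psum k t - gegenbauer_psum N t| <= gegenbauer_psum N 1 - gegenbauer_psum k 1.
Proof.
move=> N0 /subnK <- tI; elim: (k - N)%N => [|m IH]; first by rewrite !subrr normr0.
rewrite addSn; set K := (m + N)%N in IH *.
rewrite /gegenbauer_psum !(big_ord_recr K) /= -!/(gegenbauer_psum _ _).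
rewrite (gegenbauer_at1 n2) mulr1 addrAC.
apply: le_trans (ler_normD _ _) _; rewrite opprD addrA; apply: lerD => //.
have cK : c K <= 0 by apply: c0; rewrite /K; lia.
by rewrite normrM ler0_norm // ler_piMr ?oppr_ge0 // gegenbauer_le1.
Qed.

Lemma remainder_le N e t : (0 < N)%N -> -1 <= t <= 1 ->
  (forall k, (N <= k)%N -> gegenbauer_psum N 1 - gegenbauer_psum k 1 <= e) ->
  `|f t - gegenbauer_psum N t| <= e.
Proof.
move=> N0 /andP[t1 t2] he.
(* A polynomial peaking at [t], nonnegative because points of the interval are at distance at most
   2. *)
pose q (x : R) := 1 - (x - t) ^+ 2 / 4.
have nq : bdd_mfun q by rewrite /q; bdd.
have qI x : -1 <= x <= 1 -> 0 <= q x by move=> /andP[? ?]; rewrite /q; nra.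
have [p pq] : exists p : {poly R}, forall x, p.[x] = q x.
  exists (1 - 4^-1 *: ('X - t%:P) ^+ 2) => x.
  by rewrite hornerD hornerN hornerZ horner_exp hornerXsubC hornerC /q mulrC.
have nRN := nR N.
have est (sg : R) : `|sg| = 1 -> sg * (f t - gegenbauer_psum N t) - e <= 0.
  move=> sg1.
  apply: (concentration n2 (psi := fun x => sg * (f x - gegenbauer_psum N x) - e) (q := q)) => //.
  - move=> x; apply: cvgB; last exact: cvg_cst.
    by apply: cvgM; [exact: cvg_cst|exact: cR].
  - by rewrite t1.
  - move=> x x' _ _; rewrite /q -(real_normK (num_real (x - t))).
    rewrite -(real_normK (num_real (x' - t))).
    have := normr_ge0 (x - t); have := normr_ge0 (x' - t).
    by move=> h1 h2 h3; nra.
  (* With [k] above the degree of [q ^+ m], the remainder of order [k] is orthogonal to [q ^+ m];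
     only the difference of two partial sums is left, and [psum_dist] bounds it by [e]. *)
  move=> m; pose k := maxn N (size (p ^+ m)).
  have Nk : (N <= k)%N by exact: leq_maxl.
  have nRk := nR k; have nSN := nS N; have nSk := nS k.
  rewrite (@eq_wint _ _ _ (fun x => sg * ((f x - gegenbauer_psum k x) * (p ^+ m).[x])
      + 1 * ((sg * (gegenbauer_psum k x - gegenbauer_psum N x) - e) * q x ^+ m))) => [|x]; last first.
    by rewrite horner_exp pq; ring.
  rewrite (wint_lin n2); [|by bdd|by bdd].
  rewrite (@wint_low_degree _ k) ?mulr0 ?add0r ?mul1r ?leq_maxr //; last first.
    by move=> j jk; rewrite wint_remainder jk.
  rewrite -(mul0r (L (fun=> 1))) -(wintZ n2); last exact: bdd_mfun_cst.
  apply: (wint_le n2); [by bdd|by bdd|] => x xI; rewrite mul0r.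
  rewrite mulr_le0_ge0 ?exprn_ge0 ?qI // subr_le0.
  apply: le_trans (he k Nk); apply: le_trans (psum_dist N0 Nk xI).
  by rewrite (le_trans (ler_norm _)) // normrM sg1 mul1r.
have := est 1 (normr1 R); have := est (-1) ltac:(by rewrite normrN normr1).
by rewrite ler_norml; lra.
Qed.

Lemma gegenbauer_expansion e : 0 < e -> exists N0, forall N t,
  (N0 <= N)%N -> -1 <= t <= 1 -> `|f t - gegenbauer_psum N t| <= e.
Proof.
move=> e0.
(* The partial sums at 1 decrease from index 1 on and are bounded below by [f 1], so near their
   infimum all tails are at most [e]. *)
pose E := [set gegenbauer_psum N.+1 1 | N in [set: nat]].
have infE : has_inf E.
  split; first by exists (gegenbauer_psum 1 1); exists 0%N.
  by exists (f 1) => _ [N _ <-]; exact: psum_at1_ge.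
have [_ [N0 _ <-] hN0] := inf_adherent e0 infE.
exists N0.+1 => N t N0N tI; apply: remainder_le => //; first by case: N N0N.
move=> k Nk.
have h1 : inf E <= gegenbauer_psum k 1.
  apply: ge_inf; first by case: infE.
  by exists k.-1 => //; rewrite prednK //; lia.
have h2 : gegenbauer_psum N 1 <= gegenbauer_psum N0.+1 1.
  have := @psum_dist N0.+1 N 1 isT N0N ltac:(apply/andP; split; lra).
  by move=> /(le_trans (normr_ge0 _)); rewrite subr_ge0.
lra.
Qed.

End Expansion.

(** * Energy of codes *)

Section Codes.
Context {R : realType}.
Variable n : nat.
Hypothesis n2 : (2 <= n)%N.
Variables (h f : R -> R) (s : R) (M : nat).
Hypothesis feas : feasible h n s f.
Local Notation c := (gegenbauer_coef n f).

(** The squared lengths of [x + y] and [x - y] are nonnegative. *)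
Lemma inner_sphere (x y : 'rV[R]_n) : sphere x -> sphere y -> -1 <= inner x y <= 1.
Proof.
move=> x1 y1.
have pos (sg : R) : sg * sg = 1 -> 0 <= 2 + 2 * sg * inner x y.
  move=> sg1.
  have -> : 2 + 2 * sg * inner x y = \sum_(k < n) (x 0 k + sg * y 0 k) ^+ 2.
    transitivity (inner x x + 2 * sg * inner x y + sg * sg * inner y y).
      by rewrite x1 y1 sg1; ring.
    rewrite /inner !mulr_sumr -!big_split; apply: eq_bigr => k _ /=; ring.
  by apply: sumr_ge0 => k _; exact: sqr_ge0.
have := pos 1; have := pos (-1); rewrite mulrNN mulr1 => /(_ erefl) h1 /(_ erefl) h2.
by apply/andP; split; lra.
Qed.

Variable C : {fset 'rV[R]_n}.
Hypothesis CM : codes M s C.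

Definition pair_sum (g : R -> R) : R := \sum_(x <- C) \sum_(y <- C) g (inner x y).

Let C1 x : x \in C -> inner x x = 1.
Proof. by case: CM => + _ _ xC; apply. Qed.

Let CI x y : x \in C -> y \in C -> -1 <= inner x y <= 1.
Proof. by move=> xC yC; apply: inner_sphere; exact: C1. Qed.

Let Cs x y : x \in C -> y \in C -> x != y -> -1 <= inner x y <= s.
Proof.
move=> xC yC xy; have /andP[-> _] /= := CI xC yC.
by case: CM => _ _ [_]; apply; exists x, y.
Qed.

Let sum_cst (a : R) : \sum_(x <- C) a = M%:R * a.
Proof.
case: CM => _ CM' _.
by rewrite big_const_seq count_predT iter_addr_0 -CM' mulr_natl.
Qed.

Lemma energyE g : energy g C = pair_sum g - M%:R * g 1.
Proof.
apply/eqP; rewrite eq_sym subr_eq addrC; apply/eqP.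
rewrite -sum_cst -big_split /= /pair_sum; apply: eq_big_seq => x xC.
rewrite (bigD1_seq x) ?fset_uniq //= C1 //; congr (_ + _).
by apply: eq_bigl => y; rewrite eq_sym.
Qed.

Lemma moment_ge0 i : 0 <= moment i C.
Proof.
have := gegenbauer_psd n2 (r := C) (X := id) (fun=> 1) i C1.
by under eq_bigr do under eq_bigr do rewrite !mul1r.
Qed.

Lemma moment0 : moment 0 C = M%:R * M%:R.
Proof.
rewrite -sum_cst; apply: eq_bigr => x _.
by rewrite -[RHS]mulr1 -sum_cst; apply: eq_bigr => y _; rewrite hornerC.
Qed.

Lemma pair_sum_psum N : pair_sum (gegenbauer_psum n f N) = \sum_(i < N) c i * moment i C.
Proof.
rewrite /pair_sum; under eq_bigr do rewrite exchange_big.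
rewrite exchange_big; apply: eq_bigr => i _; rewrite mulr_sumr.
by apply: eq_bigr => x _; rewrite mulr_sumr.
Qed.

Lemma pair_sum_approx e : 0 < e -> exists N0, forall N, (N0 <= N)%N ->
  `|pair_sum f - \sum_(i < N) c i * moment i C| <= e.
Proof.
move=> e0; pose d := e / (M%:R * M%:R + 1).
have MM0 : 0 <= M%:R * M%:R :> R by rewrite mulr_ge0.
have d0 : 0 < d by rewrite divr_gt0 //; lra.
have [cf _ c0] := feas.
have [N0 hN0] := gegenbauer_expansion n2 cf c0 d0.
exists N0 => N NN.
rewrite -pair_sum_psum /pair_sum -sumrB.
apply: (@le_trans _ _ (\sum_(x <- C) \sum_(y <- C) d)); last first.
  rewrite !sum_cst mulrA /d mulrA ler_pdivrMr; last lra.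
  by rewrite mulrC ler_pM2l //; lra.
apply: le_trans (ler_norm_sum _ _ _) _.
rewrite big_seq [leRHS]big_seq; apply: ler_sum => x xC.
rewrite -sumrB; apply: le_trans (ler_norm_sum _ _ _) _.
rewrite big_seq [leRHS]big_seq; apply: ler_sum => y yC.
exact: hN0 NN (CI xC yC).
Qed.

Let cM i : (0 < i)%N -> c i * moment i C <= 0.
Proof.
by move=> i0; rewrite mulr_le0_ge0 ?moment_ge0 //; case: feas => _ _; apply.
Qed.

(** All terms of positive index are nonpositive and may be dropped. Keeping an arbitrary one, [j],
    also settles the equality case: equality in the bound forces that term to vanish. *)
Lemma pair_sum_le j : (0 < j)%N ->
  pair_sum f <= c 0 * (M%:R * M%:R) + c j * moment j C.
Proof.
move=> j0; apply/ler_addgt0Pr => e e0.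
have [N0 hN0] := pair_sum_approx e0.
pose N := (maxn N0 j).+1.
have := hN0 N ltac:(rewrite /N; lia).
have jN : (j < N)%N by rewrite /N; lia.
rewrite /N big_ord_recl /= moment0 ler_norml => /andP[_].
have jN' : (j.-1 < maxn N0 j)%N by lia.
rewrite (bigD1 (Ordinal jN')) //=.
have -> : bump 0 j.-1 = j by rewrite /bump add1n prednK.
set S := \sum_(i < _ | _) _ => hS.
have : S <= 0 by apply: sumr_le0 => i _; exact: cM.
by move: hS; lra.
Qed.

Lemma pair_sum_eq : (forall i, (1 <= i)%N -> c i * moment i C = 0) ->
  pair_sum f = c 0 * (M%:R * M%:R).
Proof.
move=> cM0; apply/eqP; rewrite -subr_eq0 -normr_le0; apply/ler_addgt0Pr => e e0.
have [N0 hN0] := pair_sum_approx e0.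
have := hN0 N0.+1 (leqnSn _); rewrite big_ord_recl big1 ?addr0 /= => [|i _].
  by rewrite moment0 add0r.
exact: cM0.
Qed.

Local Notation B := (M%:R * (c 0 * M%:R - f 1)).

Lemma energy_le : energy h C <= energy f C.
Proof.
rewrite /energy big_seq [leRHS]big_seq; apply: ler_sum => x xC.
rewrite big_seq_cond [leRHS]big_seq_cond; apply: ler_sum => y /andP[yC xy].
by case: feas => _ hf _; apply/hf/Cs.
Qed.

Lemma energy_eq : energy h C = energy f C <->
  (forall t, inner_products C t -> f t = h t).
Proof.
split=> [e _ [x [y [xC yC xy ->]]]|fh]; last first.
  rewrite /energy; apply: eq_big_seq => x xC.
  rewrite big_seq_cond [RHS]big_seq_cond; apply: eq_bigr => y /andP[yC xy].
  by rewrite fh //; exists x, y.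
have hf x' y' : x' \in C -> y' \in C -> x' != y' ->
    0 <= f (inner x' y') - h (inner x' y').
  by move=> x'C y'C xy'; rewrite subr_ge0; case: feas => _ hf _; apply/hf/Cs.
(* A sum of nonnegative differences that equals 0 has only zero terms. *)
have := subrr (energy h C); rewrite {1}e /energy -sumrB.
rewrite big_seq => /eqP; rewrite psumr_eq0 => [|x' x'C]; last first.
  rewrite -sumrB big_seq_cond; apply: sumr_ge0 => y' /andP[y'C]; exact: hf.
move=> /allP /(_ x xC); rewrite xC /= -sumrB big_seq_cond.
rewrite psumr_eq0 => [|y' /andP[y'C]]; last exact: hf.
by move=> /allP /(_ y yC); rewrite yC xy /= subr_eq0 => /eqP.
Qed.

Lemma energy_bound : energy f C <= B.
Proof.
have := pair_sum_le (isT : (0 < 1)%N); have := cM (isT : (0 < 1)%N).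
by rewrite energyE => h1 h2; lra.
Qed.

Lemma energy_bound_eq : energy f C = B <->
  (forall i, (1 <= i)%N -> c i * moment i C = 0).
Proof.
rewrite energyE; split=> [e i i1|/pair_sum_eq ->]; last by ring.
by apply/eqP; rewrite eq_le cM //=; have := pair_sum_le i1; lra.
Qed.

End Codes.

(** * The energy bound and its equality case *)

Theorem theorem2p2 (R : realType) (n M : nat) (s : R) (h f : R -> R)
    (C : {fset 'rV[R]_n}) :
  (2 <= n)%N -> (2 <= M)%N -> -1 <= s < 1 ->
  feasible h n s f -> codes M s C ->
  let B : R := M%:R * (gegenbauer_coef n f 0 * M%:R - f 1) in
  [/\ ((energy h C)%:E <= max_energy h n M s)%E,
      (max_energy h n M s <= B%:E)%E &
      ((energy h C)%:E = max_energy h n M s /\ max_energy h n M s = B%:E) <->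
      ((forall t, inner_products C t -> f t = h t) /\
       (forall i, (1 <= i)%N -> gegenbauer_coef n f i * moment i C = 0))].
Proof.
move=> n2 _ _ feas CM B.
have le_hf := energy_le feas CM; have le_fB := energy_bound n2 feas CM.
have hE : ((energy h C)%:E <= max_energy h n M s)%E.
  by apply: ereal_sup_ubound; exists C.
have EB : (max_energy h n M s <= B%:E)%E.
  apply: ge_ereal_sup => _ [D DM <-]; rewrite lee_fin.
  exact: le_trans (energy_le feas DM) (energy_bound n2 feas DM).
split=> //; split=> [[e1 e2]|[/(energy_eq feas CM) e1 /(energy_bound_eq n2 feas CM) e2]].
  (* Equality of the ends of [energy h C <= energy f C <= B] forces both inequalities to be
     equalities; the first gives condition (a), the second condition (b). *)
  have e : energy h C = B by apply: EFin_inj; rewrite e1.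
  split.
    by apply/(energy_eq feas CM); apply/eqP; rewrite eq_le le_hf e.
  by apply/(energy_bound_eq n2 feas CM); apply/eqP; rewrite eq_le le_fB -/B -e.
have e : (energy h C)%:E = B%:E by rewrite e1 e2.
by rewrite e in hE *; split; apply/eqP; rewrite eq_le hE EB.
Qed.
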